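(* Let $E$ be a Banach lattice. If $E$ has both the Dunford-Pettis (DP) property and the Grothendieck property, then $E$ has the L-Dunford-Pettis property.
   Context: $X'$ denotes the topological dual of a Banach space $X$. A Banach lattice is a Banach space $(E,\|\cdot\|)$ such that $E$ is a vector lattice and $|x|\le|y|$ implies $\|x\|\le\|y\|$ for all $x,y\in E$. An operator (bounded linear) between Banach spaces is completely continuous if it maps weakly null sequences to norm null sequences. A Banach space $X$ has the Dunford-Pettis property if every weakly compact operator from $X$ into another Banach space is completely continuous. A Banach space $X$ has the Grothendieck property if weak$^\star$ and weak convergence of sequences in $X'$ coincide. A norm bounded subset $A$ of $X$ is called Dunford-Pettis (DP) if every weakly null sequence $(f_n)$ in $X'$ satisfies $\lim_{n\to\infty}\sup_{x\in A}|f_n(x)|=0$. A sequence $(x_n)$ ''is a DP set'' if the set $\{x_n : n\in\mathbb{N}\}$ is a DP set. A norm bounded subset $A$ of $X'$ is called an L-Dunford-Pettis set if every weakly null sequence $(x_n)$ in $X$ which is a DP set in $X$ satisfies $\lim_{n\to\infty}\sup_{f\in A}|f(x_n)|=0$. A Banach space $X$ has the L-Dunford-Pettis property if every L-Dunford-Pettis set in $X'$ is relatively weakly compact. *)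

(* Defs.v *)
From HB Require Import structures.
From mathcomp Require Import all_boot all_order all_algebra.
From mathcomp Require Import all_classical all_reals all_analysis.

Set Implicit Arguments.
Unset Strict Implicit.
Unset Printing Implicit Defensive.

Import Order.TTheory GRing.Theory Num.Theory.
Import numFieldNormedType.Exports.

Local Open Scope classical_set_scope.
Local Open Scope ring_scope.

(* The order is a field of the mixin rather than an [Order.Lattice] structure:
   HB cannot join [Order.Preorder] with [Num.SemiNormedZmodule] once
   [Num.NumDomain], which inherits from both, is declared. *)
HB.mixin Record isVectorLattice (R : realType) E & GRing.Lmodule R E := {
  vl_le : rel E ;
  vl_join : E -> E -> E ;
  vl_meet : E -> E -> E ;
  vl_le_refl : reflexive vl_le ;
  vl_le_anti : antisymmetric vl_le ;
  vl_le_trans : transitive vl_le ;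
  vl_leUx : forall x y z : E, vl_le (vl_join x y) z = vl_le x z && vl_le y z ;
  vl_lexI : forall x y z : E, vl_le z (vl_meet x y) = vl_le z x && vl_le z y ;
  vl_leD : forall x y z : E, vl_le x y -> vl_le (x + z) (y + z) ;
  vl_leZ : forall (a : R) (x y : E),
    0 <= a -> vl_le x y -> vl_le (a *: x) (a *: y)
}.

#[short(type="vectorLatticeType")]
HB.structure Definition VectorLattice (R : realType) :=
  {E of GRing.Lmodule R E & isVectorLattice R E}.

(* The modulus of the vector lattice; [`|x|] denotes the norm. *)
Definition vl_abs (R : realType) (E : vectorLatticeType R) (x : E) : E :=
  vl_join x (- x).

HB.mixin Record isBanachLattice (R : realType) E
    & CompleteNormedModule R E & VectorLattice R E := {
  norm_vl_abs_le : forall x y : E, vl_le (vl_abs x) (vl_abs y) -> `|x| <= `|y|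
}.

#[short(type="banachLatticeType")]
HB.structure Definition BanachLattice (R : realType) :=
  {E of CompleteNormedModule R E & VectorLattice R E & isBanachLattice R E}.

Section dual.
Context {R : realType} (X : normedModType R).

Definition dual_pred : {pred (X -> R^o)} :=
  fun f => `[< linear f /\ continuous f >].

Record dual := Dual {dual_val :> X -> R^o ; _ : dual_val \in dual_pred}.

HB.instance Definition _ := [isSub for dual_val].
HB.instance Definition _ := [Choice of dual by <:].

Fact dual_submod_closed : submod_closed dual_pred.
Proof.
split=> [|a f g].
  by apply/asboolP; split=> [b x y|x]; [rewrite /= scaler0 addr0|exact: cvg_cst].
move=> /asboolP[lf cf] /asboolP[lg cg]; apply/asboolP; split=> [b x y|x].
  rewrite !fctE lf lg !scalerDr !scalerA (mulrC a b) -!addrA; congr (_ + _).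
  by rewrite addrCA.
by apply: cvgD; [apply: cvgZl_tmp; exact: cf|exact: cg].
Qed.

HB.instance Definition _ :=
  GRing.isSubmodClosed.Build R (X -> R^o) dual_pred dual_submod_closed.
HB.instance Definition _ := [SubChoice_isSubLmodule of dual by <:].

Fact dual_linear (f : dual) : linear f.
Proof. by case: f => f /= /asboolP[]. Qed.

HB.instance Definition _ (f : dual) :=
  GRing.isLinear.Build R X R^o _ f (dual_linear f).

Fact dual_continuous (f : dual) : continuous (f : X -> R^o).
Proof. by case: f => f /= /asboolP[]. Qed.

Definition dual_norm (f : dual) : R :=
  sup [set `|f x| | x in [set x : X | `|x| <= 1]].

Fact dual_norm_has_sup (f : dual) :
  has_sup [set `|f x| | x in [set x : X | `|x| <= 1]].
Proof.
split; first by exists `|f 0|, 0 => //=; rewrite normr0.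
have /linear_bounded_continuous/bounded_funP/(_ 1)[M fM] := @dual_continuous f.
by exists M => _ [x /= x1 <-]; exact: fM.
Qed.

Fact ler_dual_norm_ball (f : dual) (x : X) : `|x| <= 1 -> `|f x| <= dual_norm f.
Proof. by move=> x1; apply: (sup_upper_bound (dual_norm_has_sup f)); exists x. Qed.

Fact dual_norm_le (f : dual) (M : R) :
  (forall x, `|x| <= 1 -> `|f x| <= M) -> dual_norm f <= M.
Proof.
move=> fM; apply: ge_sup; first by case: (dual_norm_has_sup f).
by move=> _ [x /= x1 <-]; exact: fM.
Qed.

Fact dual_norm_ge0 (f : dual) : 0 <= dual_norm f.
Proof. by apply: (le_trans _ (@ler_dual_norm_ball f 0 _)); rewrite ?normr0. Qed.

Fact ler_dual_norm (f : dual) (x : X) : `|f x| <= dual_norm f * `|x|.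
Proof.
have [->|x0] := eqVneq x 0; first by rewrite linear0 !normr0 mulr0.
have nx0 : 0 < `|x| by rewrite normr_gt0.
rewrite -ler_pdivrMr// mulrC.
have -> : `|x|^-1 * `|f x| = `|f (`|x|^-1 *: x)|.
  by rewrite linearZ/= normrM normfV normr_id.
by apply: ler_dual_norm_ball; rewrite normrZ normfV normr_id mulVf// gt_eqF.
Qed.

Fact dual_normD (f g : dual) : dual_norm (f + g) <= dual_norm f + dual_norm g.
Proof.
apply: dual_norm_le => x x1; apply: (le_trans (ler_normD _ _)).
by apply: lerD; exact: ler_dual_norm_ball.
Qed.

Fact dual_normZ (a : R) (f : dual) : dual_norm (a *: f) = `|a| * dual_norm f.
Proof.
have leZ b (h : dual) : dual_norm (b *: h) <= `|b| * dual_norm h.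
  apply: dual_norm_le => x x1; rewrite [leLHS]normrM.
  by apply: ler_wpM2l => //; exact: ler_dual_norm_ball.
apply/eqP; rewrite eq_le leZ/=.
have [->|a0] := eqVneq a 0; first by rewrite normr0 mul0r dual_norm_ge0.
rewrite -ler_pdivlMl ?normr_gt0// -normfV.
by apply: le_trans (leZ _ _); rewrite scalerA mulVf// scale1r.
Qed.

Fact dual_norm0_eq0 (f : dual) : dual_norm f = 0 -> f = 0.
Proof.
move=> f0; apply: val_inj; apply/funext => x /=; apply/eqP.
by rewrite -normr_le0; have := ler_dual_norm f x; rewrite f0 mul0r.
Qed.

HB.instance Definition _ :=
  Lmodule_isNormed.Build R dual dual_normD dual_normZ dual_norm0_eq0.

End dual.

Section weak_topologies.
Context {R : realType} (X : normedModType R).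

Definition weak : Type :=
  initial_topology (fun (x : X) => (fun f : dual X => f x) : {ptws dual X -> R}).

HB.instance Definition _ := Topological.on weak.

Definition weak_star : Type :=
  initial_topology (fun (f : dual X) => (f : X -> R) : {ptws X -> R}).

HB.instance Definition _ := Topological.on weak_star.

End weak_topologies.

Section properties.
Context {R : realType}.
Implicit Types X Y : normedModType R.

Definition weak_cvg X (x : nat -> X) (l : X) : Prop :=
  (x : nat -> weak X) @ \oo --> (l : weak X).

Definition weak_star_cvg X (f : nat -> dual X) (g : dual X) : Prop :=
  (f : nat -> weak_star X) @ \oo --> (g : weak_star X).

Definition weakly_null X (x : nat -> X) : Prop := weak_cvg x 0.

Definition relatively_weakly_compact X (A : set X) : Prop :=
  precompact (A : set (weak X)).

Definition weakly_compact_operator X Y (T : X -> Y) : Prop :=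
  relatively_weakly_compact (T @` [set x : X | `|x| <= 1]).

Definition completely_continuous X Y (T : X -> Y) : Prop :=
  forall x : nat -> X, weakly_null x -> T (x n) @[n --> \oo] --> (0 : Y).

Definition dunford_pettis_property X : Prop :=
  forall (Y : completeNormedModType R) (T : {linear X -> Y}),
    continuous T -> weakly_compact_operator T -> completely_continuous T.

Definition grothendieck_property X : Prop :=
  forall (f : nat -> dual X) (g : dual X), weak_star_cvg f g <-> weak_cvg f g.

(* The suprema below are real-valued; they are taken over sets bounded above,
   as [A] is norm bounded, with [sup set0 = 0] when [A] is empty. *)
Definition dp_set X (A : set X) : Prop :=
  bounded_set A /\
  forall f : nat -> dual X, weakly_null f ->
    sup [set `|f n x| | x in A] @[n --> \oo] --> (0 : R).

Definition l_dp_set X (A : set (dual X)) : Prop :=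
  bounded_set A /\
  forall x : nat -> X, weakly_null x -> dp_set (range x) ->
    sup [set `|f (x n)| | f in A] @[n --> \oo] --> (0 : R).

Definition l_dunford_pettis_property X : Prop :=
  forall A : set (dual X), l_dp_set A -> relatively_weakly_compact A.

End properties.

(* Main.v *)
Require Import Defs.
From HB Require Import structures.
From mathcomp Require Import all_boot all_order all_algebra.
From mathcomp Require Import all_classical all_reals all_analysis.
From mathcomp Require Import ring lra.

Set Implicit Arguments.
Unset Strict Implicit.
Unset Printing Implicit Defensive.

Import Order.TTheory GRing.Theory Num.Theory.
Import numFieldNormedType.Exports.

Local Open Scope classical_set_scope.
Local Open Scope ring_scope.

(** The proof rests on the fact that, in any Banach lattice [E], a bounded set
    [A] of functionals such that [sup_A |f (x_n)|] tends to [0] for every norm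
    bounded disjoint sequence [(x_n)] of positive vectors is relatively weakly
    compact. The two properties of [E] make every L-Dunford-Pettis set such a set,
    since norm bounded disjoint sequences are then admissible test sequences.

    They are weakly null by the Grothendieck property
    ([grothendieck_disjoint_weakly_null]): if not, the restrictions of some
    [|f|] to the bands generated by [x_0 + .. + x_(N-1)] converge weak* but not
    weakly. They are DP sets by the Dunford-Pettis property
    ([dunford_pettis_dp_set]), applied to the operators [x |-> (f_n x)_n] into the
    space of null sequences, where [(f_n)] is weakly null in the dual.

    For the compactness, let [(f_n)] be a sequence of functionals dominated by [A]
    and let [p] be the lattice seminorm [x |-> sup_n |f_n|(|x|)]; it tends to [0]
    along bounded disjoint sequences. Up to a [p]-small error the ball of [E] then
    lies in an order interval [[-u, u]] ([disj_null_order_bound]); monotone sequences in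
    order intervals are [p]-Cauchy ([disj_null_monotone]); and on [[-u, u]] the
    seminorm [p] is absolutely continuous with respect to finitely many [|f_n|]
    ([dual_seminorm_abs_cont]). In [[-u, u]], as in the unit ball of an L^infinity
    space seen in L^1, a convexity argument gives convex combinations of
    successive blocks of any sequence that are close for these [|f_n|]
    ([mid_hull_close]), so the iterated limits of [f_n (z_k)] coincide
    ([disj_unif_null_iterated]). By Helly's theorem, this double limit condition
    forces weak* convergent ultrafilters on the weak* closed set of functionals
    dominated by [A] to converge weakly ([dual_dominated_weakly_compact]). *)

(** * Linear identities in modules *)

(** Formal linear combinations: the [lmodule] tactic proves an equation between
    linear combinations of vectors by comparing coefficients. *)
Inductive lin_expr (R : realType) : Type :=
  | LVar of nat
  | LZero
  | LAdd of lin_expr R & lin_expr R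
  | LOpp of lin_expr R
  | LScale of R & lin_expr R.

Fixpoint lin_eval (R : realType) (V : lmodType R) (env : seq V)
    (e : lin_expr R) : V :=
  match e with
  | LVar i => nth 0 env i
  | LZero => 0
  | LAdd a b => lin_eval env a + lin_eval env b
  | LOpp a => - lin_eval env a
  | LScale r a => r *: lin_eval env a
  end.

Fixpoint lin_coef (R : realType) (e : lin_expr R) (i : nat) : R :=
  match e with
  | LVar j => if Nat.eqb i j then 1 else 0
  | LZero => 0
  | LAdd a b => lin_coef a i + lin_coef b i
  | LOpp a => - lin_coef a i
  | LScale r a => r * lin_coef a i
  end.

Fixpoint lin_agree (R : realType) (a b : lin_expr R) (n : nat) : Prop :=
  match n with
  | 0%N => True
  | n'.+1 => lin_coef a n' = lin_coef b n' /\ lin_agree a b n'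
  end.

Lemma lin_evalE (R : realType) (V : lmodType R) (env : seq V) (e : lin_expr R) :
  lin_eval env e = \sum_(i < size env) lin_coef e i *: env`_i.
Proof.
elim: e => [j||a IHa b IHb|a IHa|r a IHa] /=.
- have [ji|ij] := ltnP j (size env).
    rewrite (bigD1 (Ordinal ji)) //= PeanoNat.Nat.eqb_refl scale1r big1 ?addr0//.
    move=> i /eqP ij; case: PeanoNat.Nat.eqb_spec => [e|_]; last by rewrite scale0r.
    by exfalso; apply: ij; apply: val_inj.
  rewrite nth_default// big1// => i _.
  case: PeanoNat.Nat.eqb_spec => [e|_]; last by rewrite scale0r.
  by have := ltn_ord i; rewrite e ltnNge ij.
- by rewrite big1// => i _; rewrite scale0r.
- by rewrite IHa IHb -big_split; apply: eq_bigr => i _; rewrite scalerDl.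
- by rewrite IHa -sumrN; apply: eq_bigr => i _; rewrite scaleNr.
- by rewrite IHa scaler_sumr; apply: eq_bigr => i _; rewrite scalerA.
Qed.

Lemma lin_agree_eval (R : realType) (V : lmodType R) (env : seq V)
    (a b : lin_expr R) :
  lin_agree a b (size env) -> lin_eval env a = lin_eval env b.
Proof.
move=> ab; rewrite !lin_evalE; apply: eq_bigr => -[i /= ilt] _; congr (_ *: _).
move: (size env) ilt ab => n; elim: n => [//|n IH].
by rewrite ltnS leq_eqVlt => /predU1P[->|/IH{}IH] [].
Qed.

Ltac lin_index x env :=
  lazymatch env with
  | cons ?y ?l =>
    match constr:(tt) with
    | _ => let _ := match constr:(tt) with _ => unify x y end in constr:(0%N)
    | _ => let n := lin_index x l in constr:(S n)
    end
  end.

Ltac lin_mem x env :=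
  lazymatch env with
  | nil => constr:(false)
  | cons ?y ?l =>
    match constr:(tt) with
    | _ => let _ := match constr:(tt) with _ => unify x y end in constr:(true)
    | _ => lin_mem x l
    end
  end.

Ltac lin_env t env :=
  lazymatch t with
  | (?a + ?b)%R => let e := lin_env a env in lin_env b e
  | (- ?a)%R => lin_env a env
  | (?r *: ?a)%R => lin_env a env
  | 0%R => env
  | _ => let m := lin_mem t env in
         lazymatch m with true => env | false => constr:(cons t env) end
  end.

Ltac lin_reify R t env :=
  lazymatch t with
  | (?a + ?b)%R =>
    let x := lin_reify R a env in let y := lin_reify R b env in
    constr:(@LAdd R x y)
  | (- ?a)%R => let x := lin_reify R a env in constr:(@LOpp R x)
  | (?r *: ?a)%R => let x := lin_reify R a env in constr:(@LScale R r x)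
  | 0%R => constr:(@LZero R)
  | _ => let n := lin_index t env in constr:(@LVar R n)
  end.

(** [lmodule R V] proves an equation in the module [V] over the field [R]; the
    conditions [_ != 0] of divisions in the scalars are left as goals. *)
Ltac lmodule R V :=
  lazymatch goal with
  | |- ?a = ?b =>
    let e0 := constr:(@nil (GRing.Lmodule.sort V)) in
    let e1 := lin_env a e0 in let e2 := lin_env b e1 in
    let x := lin_reify R a e2 in let y := lin_reify R b e2 in
    refine (@lin_agree_eval R V e2 x y _);
    cbn [lin_agree lin_coef size Nat.eqb];
    repeat split; try (by ring); try (by field)
  end.

(** * Vector lattices *)

Reserved Notation "x <=v y" (at level 70, y at next level, no associativity).
Notation "x <=v y" := (vl_le x y) : ring_scope.

(** The positive part. *)
Definition vl_pos (R : realType) (E : vectorLatticeType R) (x : E) : E :=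
  vl_join x 0.

Section vector_lattice.
Context {R : realType} {E : vectorLatticeType R}.
Implicit Types x y z u a b c : E.

Lemma vl_leDr z x y : x <=v y -> x + z <=v y + z.
Proof. exact: vl_leD. Qed.

Lemma vl_leZr (t : R) x y : 0 <= t -> x <=v y -> t *: x <=v t *: y.
Proof. exact: vl_leZ. Qed.

Lemma vl_subr_ge0 x y : (0 <=v y - x) = (x <=v y).
Proof.
apply/idP/idP => h.
  by have := vl_leDr x h; rewrite add0r subrK.
by have := vl_leDr (- x) h; rewrite subrr.
Qed.

Lemma vl_lexx x : x <=v x. Proof. exact: vl_le_refl. Qed.

Lemma vl_trans y x z : x <=v y -> y <=v z -> x <=v z.
Proof. exact: vl_le_trans. Qed.

Lemma vl_eq x y : x <=v y -> y <=v x -> x = y.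
Proof. by move=> xy yx; apply: vl_le_anti; rewrite xy. Qed.

Lemma vl_leDD a b x y : a <=v x -> b <=v y -> a + b <=v x + y.
Proof.
move=> ax b_y; apply: (@vl_trans (x + b)); first exact: vl_leDr.
by rewrite ![x + _]addrC; apply: vl_leDr.
Qed.

Lemma vl_leN x y : (- x <=v - y) = (y <=v x).
Proof. by rewrite -vl_subr_ge0 opprK addrC vl_subr_ge0. Qed.

Lemma vl_addr_ge0 x y : 0 <=v x -> 0 <=v y -> 0 <=v x + y.
Proof. by move=> x0 y0; rewrite -[0]addr0; apply: vl_leDD. Qed.

Lemma vl_scaler_ge0 (t : R) x : 0 <= t -> 0 <=v x -> 0 <=v t *: x.
Proof. by move=> t0 x0; rewrite -(scaler0 _ t); apply: vl_leZr. Qed.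

Lemma vl_leZl (s t : R) x : s <= t -> 0 <=v x -> s *: x <=v t *: x.
Proof.
by move=> st x0; rewrite -vl_subr_ge0 -scalerBl; apply: vl_scaler_ge0 => //; rewrite subr_ge0.
Qed.

Lemma vl_lejl x y : x <=v vl_join x y.
Proof. by have := vl_lexx (vl_join x y); rewrite vl_leUx => /andP[]. Qed.

Lemma vl_lejr x y : y <=v vl_join x y.
Proof. by have := vl_lexx (vl_join x y); rewrite vl_leUx => /andP[]. Qed.

Lemma vl_lemjoin x y z : x <=v z -> y <=v z -> vl_join x y <=v z.
Proof. by move=> xz yz; rewrite vl_leUx xz. Qed.

Lemma vl_lem_l x y : vl_meet x y <=v x.
Proof. by have := vl_lexx (vl_meet x y); rewrite vl_lexI => /andP[]. Qed.

Lemma vl_lem_r x y : vl_meet x y <=v y.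
Proof. by have := vl_lexx (vl_meet x y); rewrite vl_lexI => /andP[]. Qed.

Lemma vl_lemeet x y z : z <=v x -> z <=v y -> z <=v vl_meet x y.
Proof. by move=> xz yz; rewrite vl_lexI xz. Qed.

Lemma vl_meetC x y : vl_meet x y = vl_meet y x.
Proof.
by apply: vl_eq; apply: vl_lemeet; rewrite ?vl_lem_l ?vl_lem_r.
Qed.

Lemma vl_meet_mono a b x y : a <=v x -> b <=v y -> vl_meet a b <=v vl_meet x y.
Proof.
move=> ax b_y; apply: vl_lemeet.
  exact: vl_trans (vl_lem_l _ _) ax.
exact: vl_trans (vl_lem_r _ _) b_y.
Qed.

Lemma vl_leBlD x y z : (x - z <=v y) = (x <=v y + z).
Proof.
by rewrite -vl_subr_ge0 -[RHS]vl_subr_ge0; congr (_ <=v _); lmodule R E.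
Qed.

Lemma vl_leBrD x y z : (x <=v y - z) = (x + z <=v y).
Proof.
by rewrite -vl_subr_ge0 -[RHS]vl_subr_ge0; congr (_ <=v _); lmodule R E.
Qed.

Lemma vl_meetDr x y z : vl_meet x y + z = vl_meet (x + z) (y + z).
Proof.
apply: vl_eq.
  by apply: vl_lemeet; apply: vl_leDr; rewrite ?vl_lem_l ?vl_lem_r.
rewrite -vl_leBlD; apply: vl_lemeet; rewrite vl_leBlD ?vl_lem_l ?vl_lem_r//.
Qed.

Lemma vl_meetZ (t : R) x y : 0 < t ->
  t *: vl_meet x y = vl_meet (t *: x) (t *: y).
Proof.
move=> t0; apply: vl_eq.
  by apply: vl_lemeet; apply: vl_leZr; rewrite ?ltW ?vl_lem_l ?vl_lem_r.
have ti : 0 <= t^-1 by rewrite invr_ge0 ltW.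
have tK z : t *: (t^-1 *: z) = z by rewrite scalerA divff ?gt_eqF// scale1r.
have Kt z : t^-1 *: (t *: z) = z by rewrite scalerA mulVf ?gt_eqF// scale1r.
rewrite -[X in X <=v _]tK; apply: vl_leZr; first exact: ltW.
apply: vl_lemeet.
  by rewrite -[X in _ <=v X]Kt; apply: vl_leZr => //; exact: vl_lem_l.
by rewrite -[X in _ <=v X]Kt; apply: vl_leZr => //; exact: vl_lem_r.
Qed.

Lemma vl_pos_ge0 x : 0 <=v vl_pos x. Proof. exact: vl_lejr. Qed.

Lemma vl_le_pos x : x <=v vl_pos x. Proof. exact: vl_lejl. Qed.

Lemma vl_pos_le x y : x <=v y -> 0 <=v y -> vl_pos x <=v y.
Proof. exact: vl_lemjoin. Qed.

Lemma vl_pos_mono x y : x <=v y -> vl_pos x <=v vl_pos y.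
Proof.
by move=> xy; apply: vl_pos_le; rewrite ?vl_pos_ge0//; apply: vl_trans (vl_le_pos _).
Qed.

Lemma vl_pos_id x : 0 <=v x -> vl_pos x = x.
Proof. by move=> x0; apply: vl_eq; rewrite ?vl_le_pos// vl_pos_le// vl_lexx. Qed.

Lemma vl_posB x : vl_pos x - vl_pos (- x) = x.
Proof.
apply/eqP; rewrite subr_eq; apply/eqP; apply: vl_eq.
  apply: vl_pos_le.
    by rewrite -vl_subr_ge0 addrAC subrr add0r vl_pos_ge0.
  by rewrite addrC -vl_leBlD sub0r vl_le_pos.
rewrite addrC -vl_leBrD; apply: vl_pos_le.
  by rewrite vl_leBrD addNr vl_pos_ge0.
by rewrite vl_subr_ge0 vl_le_pos.
Qed.

Lemma vl_posZ (t : R) x : 0 <= t -> vl_pos (t *: x) = t *: vl_pos x.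
Proof.
rewrite le_eqVlt => /predU1P[<-|t0].
  by rewrite !scale0r vl_pos_id// vl_lexx.
have leZ (s : R) y : 0 < s -> vl_pos (s *: y) <=v s *: vl_pos y.
  move=> s0; apply: vl_pos_le.
    by apply: vl_leZr; rewrite ?vl_le_pos// ltW.
  by apply: vl_scaler_ge0; rewrite ?vl_pos_ge0// ltW.
apply: vl_eq; first exact: leZ.
have := leZ t^-1 (t *: x); rewrite invr_gt0 => /(_ t0).
rewrite scalerA mulVf ?gt_eqF// scale1r => /(vl_leZr (ltW t0)).
by rewrite scalerA divff ?gt_eqF// scale1r.
Qed.

Lemma vl_abs_le x y : x <=v y -> - x <=v y -> vl_abs x <=v y.
Proof. exact: vl_lemjoin. Qed.

Lemma vl_le_abs x : x <=v vl_abs x. Proof. exact: vl_lejl. Qed.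

Lemma vl_leN_abs x : - x <=v vl_abs x. Proof. exact: vl_lejr. Qed.

Lemma vl_lemul2 x : 0 <=v x + x -> 0 <=v x.
Proof.
move=> xx; have -> : x = 2^-1 *: (x + x) by lmodule R E.
by apply: vl_scaler_ge0; rewrite ?invr_ge0.
Qed.

Lemma vl_abs_ge0 x : 0 <=v vl_abs x.
Proof.
apply: vl_lemul2; rewrite -(subrr x).
by apply: vl_leDD; rewrite ?vl_le_abs ?vl_leN_abs.
Qed.

Lemma vl_absE x : 0 <=v x -> vl_abs x = x.
Proof.
move=> x0; apply: vl_eq; last exact: vl_le_abs.
apply: vl_abs_le; rewrite ?vl_lexx//.
by apply: (vl_trans _ x0); rewrite -oppr0 vl_leN.
Qed.

Lemma vl_absN x : vl_abs (- x) = vl_abs x.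
Proof.
by apply: vl_eq; apply: vl_abs_le; rewrite ?opprK ?vl_le_abs ?vl_leN_abs//;
  have := vl_leN_abs (- x); rewrite ?opprK.
Qed.

Lemma vl_absD x y : vl_abs (x + y) <=v vl_abs x + vl_abs y.
Proof.
by apply: vl_abs_le; rewrite ?opprD; apply: vl_leDD; rewrite ?vl_le_abs ?vl_leN_abs.
Qed.

Lemma vl_abs_abs x : vl_abs (vl_abs x) = vl_abs x.
Proof. exact: vl_absE (vl_abs_ge0 _). Qed.

Lemma vl_abs_mono x y : 0 <=v x -> x <=v y -> vl_abs x <=v vl_abs y.
Proof. by move=> x0 xy; rewrite !vl_absE//; apply: vl_trans xy. Qed.

Lemma vl_pos_le_abs x : vl_pos x <=v vl_abs x.
Proof. by apply: vl_pos_le; rewrite ?vl_le_abs ?vl_abs_ge0. Qed.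

Lemma vl_abs0 : vl_abs (0 : E) = 0. Proof. by rewrite vl_absE ?vl_lexx. Qed.

Lemma vl_absZ (t : R) x : 0 <= t -> vl_abs (t *: x) = t *: vl_abs x.
Proof.
move=> t0; apply: vl_eq.
  apply: vl_abs_le; rewrite -?scalerN; apply: vl_leZr => //;
  by rewrite ?vl_le_abs ?vl_leN_abs.
move: t0; rewrite le_eqVlt => /predU1P[<-|t0]; first by rewrite !scale0r vl_abs_ge0.
have -> : vl_abs (t *: x) = t *: (t^-1 *: vl_abs (t *: x)).
  by rewrite scalerA divff ?gt_eqF// scale1r.
apply: vl_leZr; first exact: ltW.
have ti : 0 <= t^-1 by rewrite invr_ge0 ltW.
apply: vl_abs_le.
  by have := vl_leZr ti (vl_le_abs (t *: x)); rewrite scalerA mulVf ?gt_eqF// scale1r.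
by have := vl_leZr ti (vl_leN_abs (t *: x)); rewrite scalerN scalerA mulVf ?gt_eqF// scale1r.
Qed.

Lemma vl_meet_ge0 x y : 0 <=v x -> 0 <=v y -> 0 <=v vl_meet x y.
Proof. exact: vl_lemeet. Qed.

Lemma vl_meet_pos_neg x : vl_meet (vl_pos x) (vl_pos (- x)) = 0.
Proof.
set m := vl_meet _ _.
have h : vl_meet (vl_pos x - m) (vl_pos (- x) - m) = 0.
  by rewrite -vl_meetDr subrr.
apply: vl_eq; last by apply: vl_meet_ge0; exact: vl_pos_ge0.
have hx : vl_pos x <=v vl_pos x - m.
  apply: vl_pos_le; last by rewrite -h vl_lem_l.
  rewrite -[X in X <=v _]vl_posB; rewrite -vl_subr_ge0.
  have -> : vl_pos x - m - (vl_pos x - vl_pos (- x)) = vl_pos (- x) - m.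
    by lmodule R E.
  by rewrite -h vl_lem_r.
rewrite -vl_leN oppr0 -(addKr (vl_pos x) (- m)) addrC.
by rewrite -vl_leBlD sub0r opprK.
Qed.

Lemma vl_disj_mono a b x y : 0 <=v a -> 0 <=v b -> a <=v x -> b <=v y ->
  vl_meet x y = 0 -> vl_meet a b = 0.
Proof.
move=> a0 b0 ax b_y xy; apply: vl_eq; last exact: vl_meet_ge0.
by rewrite -xy; apply: vl_meet_mono.
Qed.

Lemma vl_disj_pos (t : R) a b : 0 < t -> a <=v - (t *: b) ->
  vl_meet (vl_pos a) (vl_pos b) = 0.
Proof.
move=> t0 ab.
have tb : vl_pos b = t^-1 *: vl_pos (t *: b).
  by rewrite vl_posZ ?ltW// scalerA mulVf ?gt_eqF// scale1r.
set s := Num.max 1 t^-1.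
have s0 : 0 < s by rewrite lt_max ltr01.
apply: (@vl_disj_mono _ _ (s *: vl_pos (- (t *: b))) (s *: vl_pos (t *: b))).
- exact: vl_pos_ge0.
- exact: vl_pos_ge0.
- apply: vl_trans (vl_pos_mono ab) _.
  rewrite -[X in X <=v _]scale1r; apply: vl_leZl; last exact: vl_pos_ge0.
  by rewrite le_max lexx.
- rewrite tb; apply: vl_leZl; last exact: vl_pos_ge0.
  by rewrite le_max lexx orbT.
rewrite -vl_meetZ//.
by rewrite vl_meetC vl_meet_pos_neg scaler0.
Qed.

Lemma vl_meetD x a b : 0 <=v x -> 0 <=v a -> 0 <=v b ->
  vl_meet x (a + b) <=v vl_meet x a + vl_meet x b.
Proof.
move=> x0 a0 b0; rewrite (vl_meetDr x a).
have xb0 : 0 <=v vl_meet x b by exact: vl_meet_ge0.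
apply: vl_lemeet.
  apply: vl_trans (vl_lem_l _ _) _.
  by rewrite -[X in X <=v _]addr0; apply: vl_leDD; rewrite ?vl_lexx.
rewrite [X in _ <=v X]addrC vl_meetDr; apply: vl_lemeet.
  apply: vl_trans (vl_lem_l _ _) _.
  by rewrite -[X in X <=v _]addr0; apply: vl_leDD; rewrite ?vl_lexx.
by rewrite [X in _ <=v X]addrC; exact: vl_lem_r.
Qed.

(** The truncation of [x] to the order interval [[-u, u]]. *)
Definition vl_trunc u x : E := vl_join (vl_meet x u) (- u).

Lemma vl_abs_trunc u x : 0 <=v u -> vl_abs (vl_trunc u x) <=v u.
Proof.
move=> u0; apply: vl_abs_le.
  apply: vl_lemjoin; first exact: vl_lem_r.
  by apply: (vl_trans _ u0); rewrite -oppr0 vl_leN.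
by rewrite -[X in _ <=v X]opprK vl_leN vl_lejr.
Qed.

Lemma vl_trunc_dist u x : 0 <=v u ->
  vl_abs (x - vl_trunc u x) <=v vl_pos (vl_abs x - u).
Proof.
move=> u0; set s := vl_pos _.
have xs : vl_abs x <=v u + s by rewrite addrC -vl_leBlD vl_le_pos.
have s0 : 0 <=v s := vl_pos_ge0 _.
apply: vl_abs_le.
  rewrite vl_leBlD addrC.
  apply: (@vl_trans (vl_meet x u + s)); last by apply: vl_leDr; exact: vl_lejl.
  rewrite vl_meetDr; apply: vl_lemeet.
    by rewrite addrC -vl_leBlD subrr.
  exact: vl_trans (vl_le_abs _) xs.
rewrite opprB vl_leBlD; apply: vl_lemjoin.
  apply: vl_trans (vl_lem_l _ _) _.
  by rewrite -vl_leBlD subrr.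
rewrite addrC -vl_leBlD -opprD -[X in _ <=v X]opprK vl_leN.
exact: vl_trans (vl_leN_abs _) xs.
Qed.

(** The Riesz decomposition property. *)
Lemma vl_riesz y a b : 0 <=v a -> 0 <=v b -> vl_abs y <=v a + b ->
  exists y1 y2, [/\ y = y1 + y2, vl_abs y1 <=v a & vl_abs y2 <=v b].
Proof.
move=> a0 b0 yab; exists (vl_trunc a y), (y - vl_trunc a y); split.
- by rewrite addrC subrK.
- exact: vl_abs_trunc.
- apply: vl_trans (vl_trunc_dist _ a0) _; apply: vl_pos_le => //.
  by rewrite vl_leBlD addrC.
Qed.

(** The slice of [|a - b|] at the level [c]. For real numbers it is twice the
    distance from [c] to the nearer of [a] and [b] when [c] lies between them, and
    [0] otherwise. It is both the convexity defect of [x |-> |x - c|] between [a]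
    and [b], and a vector that is disjoint from the later slices at [c] along a
    monotone sequence ([vl_slice_le]). *)
Definition vl_slice a b c : E :=
  vl_abs (a - c) + vl_abs (b - c) - vl_abs (a + b - 2 *: c).

Lemma vl_slice_ge0 a b c : 0 <=v vl_slice a b c.
Proof.
rewrite vl_subr_ge0; apply: vl_trans (vl_absD _ _).
by (have -> : a + b - 2 *: c = a - c + (b - c) by lmodule R E); exact: vl_lexx.
Qed.

Lemma vl_slice_sub a b c : vl_abs (a - b) - vl_slice a b c <=v vl_abs (a + b - 2 *: c).
Proof.
rewrite vl_leBlD /vl_slice [X in _ <=v X]addrC subrK.
have -> : a - b = (a - c) + - (b - c) by lmodule R E.
by rewrite -(vl_absN (b - c)); exact: vl_absD.
Qed.

Lemma vl_abs_add_le a b c : a + b <=v c -> a - b <=v c -> - a + b <=v c ->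
  - a - b <=v c -> vl_abs a + vl_abs b <=v c.
Proof.
move=> h1 h2 h3 h4; rewrite -vl_leBrD; apply: vl_abs_le; rewrite vl_leBrD addrC -vl_leBrD;
  by apply: vl_abs_le; rewrite vl_leBrD addrC.
Qed.

Lemma vl_slice_le a b c : b <=v a ->
  vl_slice a b c <=v 2 *: vl_pos (a - c) /\
  vl_slice a b c <=v 2 *: vl_pos (c - b).
Proof.
move=> ba; rewrite !vl_leBlD.
set s := vl_abs (a + b - 2 *: c).
have s0 : 0 <=v s := vl_abs_ge0 _.
have p0 x : 0 <=v 2 *: vl_pos x by apply: vl_scaler_ge0; rewrite ?vl_pos_ge0.
have leD0 x y z : x <=v z -> 0 <=v y -> x <=v y + z.
  by move=> xz y0; rewrite -[x]add0r; exact: vl_leDD.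
have h1 : a - c + (b - c) <=v s.
  by (have -> : a - c + (b - c) = a + b - 2 *: c by lmodule R E); exact: vl_le_abs.
have h2 : - (a - c) - (b - c) <=v s.
  have -> : - (a - c) - (b - c) = - (a + b - 2 *: c) by lmodule R E.
  exact: vl_leN_abs.
have h3 : - (a - c) + (b - c) <=v s.
  apply: (vl_trans _ s0).
  by (have -> : - (a - c) + (b - c) = b - a by lmodule R E); rewrite vl_leBlD add0r.
split; apply: vl_abs_add_le; try (by apply: leD0).
  have -> : a - c - (b - c) = 2 *: (a - c) - (a + b - 2 *: c) by lmodule R E.
  apply: vl_leDD; last exact: vl_leN_abs.
  by apply: vl_leZr; rewrite ?vl_le_pos.
have -> : a - c - (b - c) = 2 *: (c - b) + (a + b - 2 *: c) by lmodule R E.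
apply: vl_leDD; last exact: vl_le_abs.
by apply: vl_leZr; rewrite ?vl_le_pos.
Qed.

(** One step of a finite grid: a vector that lies below the join of [h] and
    [c + 2h], and below [|c|], lies below the join of [h] and [c]. The joins are
    written with positive parts. *)
Lemma vl_grid_step h c x :
  x - h <=v vl_pos (c + h) -> x <=v vl_abs c -> x - h <=v vl_pos (c - h).
Proof.
move=> xP xc.
have xQ : x - h <=v vl_pos (c - h) + vl_pos (- (c + h)).
  rewrite vl_leBlD; apply: vl_trans xc _; apply: vl_abs_le.
    rewrite -vl_leBlD; apply: (vl_trans (vl_le_pos _)).
    by rewrite -vl_subr_ge0 addrC addKr vl_pos_ge0.
  rewrite -vl_leBlD -opprD; apply: (vl_trans (vl_le_pos _)).
  by rewrite -vl_subr_ge0 addrK vl_pos_ge0.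
have : x - h <=v vl_meet (vl_pos (c + h)) (vl_pos (c - h) + vl_pos (- (c + h))).
  exact: vl_lemeet.
move=> /vl_trans; apply.
apply: (vl_trans (vl_meetD _ _ _)); rewrite ?vl_pos_ge0//.
by rewrite vl_meet_pos_neg addr0; exact: vl_lem_r.
Qed.

(** A difference of two vectors of [[-u, u]] is, up to [h *: u], the sum of its
    slices at the levels of a grid of step [h]. *)
Lemma vl_grid u a b (h : R) (N : nat) : 0 <=v u -> 0 < h -> 2 <= h * N%:R ->
  vl_abs a <=v u -> vl_abs b <=v u ->
  vl_abs (a - b) <=v
    h *: u + \sum_(0 <= j < N.+1) vl_slice a b ((h * j%:R - 1) *: u).
Proof.
move=> u0 h0 hN au bu.
pose t (j : nat) : R := h * j%:R - 1.
pose S (j : nat) := \sum_(0 <= i < j.+1) vl_slice a b (t i *: u).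
have Nle x : vl_abs x <=v u -> - u <=v x.
  move=> xu; rewrite -[x]opprK vl_leN; exact: vl_trans (vl_leN_abs _) xu.
have S0 j : 0 <=v S j.
  rewrite /S; elim: j.+1 => [|k IH]; first by rewrite big_geq// vl_lexx.
  by rewrite big_nat_recr//=; apply: vl_addr_ge0 => //; exact: vl_slice_ge0.
(* what is left after the levels up to [t j] lies below the join of [h *: u] and
   [a + b - (2 * t j) *: u] *)
have key j : vl_abs (a - b) - S j - h *: u <=v
    vl_pos (a + b - (2 * t j) *: u - h *: u).
  elim: j => [|j IH].
    apply: vl_trans (vl_le_pos _); apply: vl_leDr.
    rewrite /S big_nat1; apply: (vl_trans (vl_slice_sub _ _ _)).
    rewrite scalerA vl_absE ?vl_lexx// /t mulr0 sub0r.
    have -> : a + b - (2 * -1) *: u = (a + u) + (b + u) by lmodule R E.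
    by apply: vl_addr_ge0; rewrite -vl_leBlD sub0r Nle.
  apply: vl_grid_step.
    have -> : a + b - (2 * t j.+1) *: u + h *: u = a + b - (2 * t j) *: u - h *: u.
      by rewrite /t -[j.+1]addn1 natrD; lmodule R E.
    apply: vl_trans IH; apply: vl_leDr.
    rewrite /S big_nat_recr//= -/(S j) -vl_subr_ge0.
    have -> : vl_abs (a - b) - S j -
       (vl_abs (a - b) - (S j + vl_slice a b (t j.+1 *: u))) =
       vl_slice a b (t j.+1 *: u) by lmodule R E.
    exact: vl_slice_ge0.
  rewrite -scalerA; apply: vl_trans (vl_slice_sub _ _ _).
  rewrite /S big_nat_recr//= -/(S j) -vl_subr_ge0.
  set m := vl_slice _ _ _.
  have -> : vl_abs (a - b) - m - (vl_abs (a - b) - (S j + m)) = S j by lmodule R E.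
  exact: S0.
have := key N.
have -> : vl_pos (a + b - (2 * t N) *: u - h *: u) = 0.
  apply: vl_eq; last exact: vl_pos_ge0.
  apply: vl_pos_le; rewrite ?vl_lexx//.
  apply: (@vl_trans (u + u - (2 * t N) *: u - h *: u)).
    do 2! apply: vl_leDr.
    by apply: vl_leDD; [exact: vl_trans (vl_le_abs _) au|exact: vl_trans (vl_le_abs _) bu].
  have -> : u + u - (2 * t N) *: u - h *: u = - ((2 * t N + h - 2) *: u) by lmodule R E.
  rewrite -oppr0 vl_leN; apply: vl_scaler_ge0 => //.
  rewrite /t; lra.
by rewrite -addrA -opprD vl_leBlD add0r [X in _ <=v X]addrC.
Qed.

End vector_lattice.

(** * Lattice seminorms on a Banach lattice *)

Section banach_lattice.
Context {R : realType} {E : banachLatticeType R}.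
Implicit Types x y z u e : E.

Lemma vl_norm_abs x : `|vl_abs x| = `|x|.
Proof. by apply: le_anti; rewrite !norm_vl_abs_le ?vl_abs_abs ?vl_lexx. Qed.

Lemma vl_norm_le x y : 0 <=v x -> x <=v y -> `|x| <= `|y|.
Proof. by move=> x0 xy; apply: norm_vl_abs_le; exact: vl_abs_mono. Qed.

Lemma vl_norm_pos x : `|vl_pos x| <= `|x|.
Proof.
by rewrite -(vl_norm_abs x); apply: vl_norm_le (vl_pos_ge0 _) (vl_pos_le_abs _).
Qed.

(** Order intervals are norm closed. *)
Lemma vl_le_lim (y : nat -> E) z e :
  y @ \oo --> e -> (\forall n \near \oo, z <=v y n) -> z <=v e.
Proof.
move=> ye zy; suff : vl_pos (z - e) = 0.
  by move=> ze; rewrite -[e]add0r -vl_leBlD -ze; exact: vl_le_pos.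
apply/eqP; rewrite -normr_le0; apply/ler_addgt0Pl => d d0; rewrite addr0.
have /cvgrPdist_le/(_ _ d0) := ye.
move=> yd; have [n [zn dn]] : exists n, z <=v y n /\ `|e - y n| <= d.
  by have /(_ _) := @filter_ex _ \oo _ _ (filterI zy yd); case=> n [] ? ?; exists n.
apply: le_trans dn; rewrite distrC; apply: le_trans (vl_norm_pos _).
by apply: vl_norm_le; rewrite ?vl_pos_ge0// vl_pos_mono// vl_leDr.
Qed.

(** A subadditive function that is monotone for the modulus and dominated by [C]
    times the norm; homogeneity is not part of the definition. *)
Definition lattice_seminorm (C : R) (p : E -> R) : Prop :=
  [/\ forall x y, vl_abs x <=v vl_abs y -> p x <= p y,
      forall x y, p (x + y) <= p x + p y
    & forall x, p x <= C * `|x| ].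

(** Sequences of pairwise disjoint positive vectors. *)
Definition disjoint_seq (x : nat -> E) : Prop :=
  (forall n, 0 <=v x n) /\ (forall n m, (n < m)%N -> vl_meet (x n) (x m) = 0).

(** [p] tends to [0] along the norm bounded disjoint sequences. *)
Definition disj_null (p : E -> R) : Prop :=
  forall (x : nat -> E) (K : R), disjoint_seq x -> (forall n, `|x n| <= K) ->
  forall eps, 0 < eps -> exists N, forall n, (N <= n)%N -> p (x n) <= eps.

Lemma exp2N_small (M d : R) : 0 < d ->
  exists N, forall n, (N <= n)%N -> M * 2^-1 ^+ n <= d.
Proof.
move=> d0; have [N MN] : exists N : nat, `|M| / d <= N%:R.
  exists (Num.truncn (`|M| / d)).+1; apply: ltW.
  by rewrite truncnS_gt.
exists N => n Nn.
have h : `|M| / d <= 2 ^+ n.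
  apply: le_trans MN _; rewrite -natrX ler_nat (leq_trans Nn)//.
  exact: ltnW (ltn_expl _ _).
apply: le_trans (ler_wpM2r _ (ler_norm M)) _; first by rewrite exprn_ge0// invr_ge0.
by rewrite exprVn ler_pdivrMr ?exprn_gt0// mulrC -ler_pdivrMr.
Qed.

Section seminorm.
Variables (C : R) (p : E -> R).
Hypothesis (pS : lattice_seminorm C p).

Lemma seminorm_mono x y : 0 <=v x -> x <=v y -> p x <= p y.
Proof. by case: pS => pm _ _ x0 xy; apply: pm; exact: vl_abs_mono. Qed.

Lemma seminorm_abs x : p (vl_abs x) = p x.
Proof. by case: pS => pm _ _; apply: le_anti; rewrite !pm ?vl_abs_abs ?vl_lexx. Qed.

Lemma seminorm_sum (I : Type) (s : seq I) (F : I -> E) :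
  p (\sum_(i <- s) F i) <= \sum_(i <- s) p (F i).
Proof.
have [pm pD pC] := pS; elim: s => [|i s IH].
  by rewrite !big_nil; have := pC 0; rewrite normr0 mulr0.
by rewrite !big_cons; apply: le_trans (pD _ _) _; rewrite lerD2l.
Qed.

(** Up to a [p]-small part, the ball of radius [K] is order bounded. If no [u]
    works, there are moduli [x_n] of vectors of the ball whose excess over
    [4^n (x_0 + .. + x_(n-1))] is [p]-large; subtracting [2^-n \sum_i 2^-i x_i]
    from these excesses makes them disjoint and changes them little. *)
Lemma disj_null_order_bound (K eps : R) : disj_null p -> 0 < eps ->
  exists u, 0 <=v u /\ forall x, `|x| <= K -> p (vl_pos (vl_abs x - u)) <= eps.
Proof.
move=> pdn eps0; apply: contrapT => H.
have {}H u : exists x, 0 <=v u -> `|x| <= K /\ eps < p (vl_pos (vl_abs x - u)).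
  have [u0|u0] := boolP (0 <=v u); last by exists 0.
  apply: contrapT => Hu; apply: H; exists u; split=> // x xK.
  by rewrite leNgt; apply/negP => px; apply: Hu; exists x.
have [X XP] := choice H.
pose S := fix S n : E :=
  if n is n'.+1 then S n' + vl_abs (X (4 ^+ n' *: S n')) else 0.
pose x n := vl_abs (X (4 ^+ n *: S n)).
have x0 n : 0 <=v x n := vl_abs_ge0 _.
have S0 n : 0 <=v S n.
  elim: n => [|n IH] /=; first exact: vl_lexx.
  by apply: vl_addr_ge0 => //; exact: vl_abs_ge0.
have xS n m : (n < m)%N -> x n <=v S m.
  elim: m => // m IH; rewrite ltnS leq_eqVlt => /predU1P[->|/IH h] /=.
    by rewrite -[X in X <=v _]add0r; apply: vl_leDD; rewrite ?vl_lexx.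
  by rewrite -[X in X <=v _]addr0; apply: vl_leDD => //; exact: vl_abs_ge0.
have XS n := XP (4 ^+ n *: S n) (vl_scaler_ge0 (exprn_ge0 n (ler0n R 4)) (S0 n)).
have xK n : `|x n| <= K by rewrite vl_norm_abs; case: (XS n).
have K0 : 0 <= K by apply: le_trans (xK 0%N).
have half0 n : 0 <= (2^-1 : R) ^+ n by rewrite exprn_ge0// invr_ge0.
pose y n := (2^-1) ^+ n *: x n : E.
have y0 n : 0 <=v y n by exact: vl_scaler_ge0.
have cy : cvgn (series y).
  apply: normed_cvg; apply: (@series_le_cvg _ _ (geometric K 2^-1)).
  - by move=> n /=.
  - by move=> n; rewrite /= mulr_ge0.
  - move=> n /=; rewrite normrZ ger0_norm// mulrC.
    by apply: ler_wpM2r.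
  - by apply: is_cvg_geometric_series; rewrite ger0_norm ?invr_ge0// invf_lt1// ltr1n.
pose e := limn (series y).
have ye n : y n <=v e.
  apply: (vl_le_lim cy); exists n.+1 => // m /= nm.
  rewrite /series /= (bigD1_seq n) ?mem_index_iota ?iota_uniq//=.
  rewrite -[X in X <=v _]addr0; apply: vl_leDD; rewrite ?vl_lexx//.
  by elim/big_ind : _ => [|a b|i _]; rewrite ?vl_lexx//; exact: vl_addr_ge0.
have e0 : 0 <=v e by exact: vl_trans (ye 0%N).
pose v n := vl_pos (x n - 4 ^+ n *: S n - (2^-1) ^+ n *: e).
have vd : disjoint_seq v.
  split=> [n|n m nm]; first exact: vl_pos_ge0.
  apply: (@vl_disj_mono _ _ _ _ (vl_pos (x n - (2^-1) ^+ (n + m) *: x m))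
    (vl_pos (x m - 4 ^+ m *: x n))); rewrite ?vl_pos_ge0//.
  - apply: vl_pos_mono; rewrite -!addrA; apply: vl_leDD; first exact: vl_lexx.
    rewrite -opprD vl_leN exprD -scalerA -[X in X <=v _]add0r.
    apply: vl_leDD; first by apply: vl_scaler_ge0; rewrite ?exprn_ge0.
    by apply: vl_leZr => //; exact: ye.
  - apply: vl_pos_mono; rewrite -!addrA; apply: vl_leDD; first exact: vl_lexx.
    rewrite -opprD vl_leN -[X in X <=v _]addr0; apply: vl_leDD.
      by apply: vl_leZr; [exact: exprn_ge0|exact: xS].
    by apply: vl_scaler_ge0.
  - apply: (@vl_disj_pos _ _ ((2^-1) ^+ (n + m))); first by rewrite exprn_gt0// invr_gt0.
    rewrite scalerBr opprB scalerA; apply: vl_leDr.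
    rewrite -[X in X <=v _]scale1r; apply: vl_leZl => //.
    have -> : (4 : R) = 2 ^+ 2 by rewrite -natrX.
    rewrite -exprM exprVn mulrC -[(2 * m)%N]/((2 * m)%N) ler_pdivlMr ?exprn_gt0// mul1r.
    by apply: ler_weXn2l; [rewrite ler1n|rewrite mul2n -addnn leq_add2r ltnW].
have vK n : `|v n| <= K.
  apply: le_trans (xK n); apply: vl_norm_le; first exact: vl_pos_ge0.
  apply: vl_pos_le => //.
  rewrite -addrA -opprD vl_leBlD -[X in X <=v _]addr0; apply: vl_leDD; rewrite ?vl_lexx//.
  by apply: vl_addr_ge0; apply: vl_scaler_ge0; rewrite ?exprn_ge0.
have eps20 : 0 < eps / 2 by rewrite divr_gt0.
have [N1 hN1] := pdn v K vd vK _ eps20.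
have [N2 hN2] := exp2N_small (C * `|e|) eps20.
pose n := maxn N1 N2.
have [_ ] := XS n; rewrite -/(x n); apply/negP; rewrite -leNgt.
have [pm pD pC] := pS.
apply: (@le_trans _ _ (p (v n + (2^-1) ^+ n *: e))).
  apply: seminorm_mono; first exact: vl_pos_ge0.
  apply: vl_pos_le; last by apply: vl_addr_ge0; rewrite ?vl_pos_ge0// vl_scaler_ge0.
  by rewrite -vl_leBlD; exact: vl_le_pos.
apply: le_trans (pD _ _) _; rewrite [leRHS](splitr eps); apply: lerD.
  by apply: hN1; rewrite leq_maxl.
apply: le_trans (pC _) _; rewrite normrZ ger0_norm// mulrCA mulrC.
by apply: hN2; rewrite leq_maxr.
Qed.

(** Monotone sequences in an order interval are [p]-Cauchy: along such a
    sequence, the slices of the successive differences at a fixed level are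
    disjoint. *)
Lemma disj_null_monotone u (x : nat -> E) (eps : R) : disj_null p ->
  0 <=v u -> (forall n, vl_abs (x n) <=v u) ->
  (forall n m, (n <= m)%N -> x n <=v x m) -> 0 < eps ->
  exists N, forall m, (N <= m)%N -> p (x m - x N) <= eps.
Proof.
move=> pdn u0 xu xm eps0; apply: contrapT => H.
have {}H N : exists m, (N <= m)%N /\ eps < p (x m - x N).
  apply: contrapT => HN; apply: H; exists N => m Nm.
  by rewrite leNgt; apply/negP => h; apply: HN; exists m.
have [f fP] := choice H.
pose k := fix k n : nat := if n is n'.+1 then f (k n') else 0%N.
pose z n := x (k n).
have zle n m : (n <= m)%N -> z n <=v z m.
  elim: m => [|m IH]; first by rewrite leqn0 => /eqP ->; exact: vl_lexx.
  rewrite leq_eqVlt => /predU1P[->|]; first exact: vl_lexx.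
  by rewrite ltnS => /IH h; apply: (vl_trans h); apply: xm; case: (fP (k m)).
have zu n : vl_abs (z n) <=v u by exact: xu.
pose h : R := eps / (2 * (`|C| * `|u| + 1)).
have den : 0 < `|C| * `|u| + 1 by rewrite ltr_wpDl// mulr_ge0.
have h0 : 0 < h by rewrite divr_gt0// mulr_gt0.
have [J hJ] : exists J : nat, 2 <= h * J%:R.
  exists (Num.truncn (2 / h)).+1; rewrite mulrC -ler_pdivrMr//.
  by apply: ltW; rewrite truncnS_gt.
pose c (j : nat) := (h * j%:R - 1) *: u.
pose s j n := vl_slice (z n.+1) (z n) (c j).
have sd j : disjoint_seq (s j).
  split=> [n|n m nm]; first exact: vl_slice_ge0.
  have [s1 _] := vl_slice_le (c j) (zle _ _ (leqnSn n)).
  have [_ s2] := vl_slice_le (c j) (zle _ _ (leqnSn m)).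
  apply: (@vl_disj_mono _ _ _ _ (2 *: vl_pos (z n.+1 - c j)) (2 *: vl_pos (c j - z n.+1))).
  - exact: vl_slice_ge0.
  - exact: vl_slice_ge0.
  - exact: s1.
  - apply: (vl_trans s2); apply: vl_leZr => //; apply: vl_pos_mono.
    by apply: vl_leDD; rewrite ?vl_lexx// vl_leN zle.
  - by rewrite -vl_meetZ// -(opprB (z n.+1)) vl_meet_pos_neg scaler0.
have sK j n : `|s j n| <= 2 * (`|u| + `|c j|).
  have [s1 _] := vl_slice_le (c j) (zle _ _ (leqnSn n)).
  apply: le_trans (vl_norm_le (vl_slice_ge0 _ _ _) s1) _.
  rewrite normrZ ger0_norm// ler_wpM2l//; apply: le_trans (vl_norm_pos _) _.
  apply: le_trans (ler_normB _ _) _; rewrite lerD2r -vl_norm_abs.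
  exact: vl_norm_le (vl_abs_ge0 _) (zu _).
pose d := eps / (4 * J.+1%:R).
have d0 : 0 < d by rewrite divr_gt0// mulr_gt0.
have [N hN] : exists N, forall j, (j < J.+1)%N -> forall n, (N <= n)%N -> p (s j n) <= d.
  elim: J.+1 => [|L [N1 h1]]; first by exists 0%N.
  have [N2 h2] := pdn _ _ (sd L) (sK L) _ d0.
  exists (maxn N1 N2) => j; rewrite ltnS leq_eqVlt => /predU1P[->|jL] n nN.
    by apply: h2; apply: leq_trans nN; rewrite leq_maxr.
  by apply: h1 => //; apply: leq_trans nN; rewrite leq_maxl.
have [pm pD pC] := pS.
have [_] := fP (k N); rewrite -/(z N) -[x _]/(z N.+1); apply/negP; rewrite -leNgt.
have zz := zle _ _ (leqnSn N).
rewrite -seminorm_abs.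
apply: le_trans (seminorm_mono (vl_abs_ge0 _) (vl_grid u0 h0 hJ (zu _) (zu _))) _.
apply: le_trans (pD _ _) _; rewrite [leRHS](splitr eps); apply: lerD.
  apply: le_trans (pC _) _; rewrite normrZ gtr0_norm//.
  rewrite /h mulrCA -ler_pdivlMl ?divr_gt0 ?mulr_gt0//.
  have -> : (eps / (2 * (`|C| * `|u| + 1)))^-1 * (eps / 2) = `|C| * `|u| + 1.
    by field; rewrite !gt_eqF.
  by apply: ler_wpDr => //; rewrite ler_wpM2r// ler_norm.
apply: le_trans (seminorm_sum _ _) _.
rewrite big_nat; apply: le_trans (ler_sum _ (G := fun=> d) _) _.
  by move=> j /andP[_ jJ]; exact: hN.
rewrite -big_nat sumr_const_nat subn0 -[X in X <= _]mulr_natl /d.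
have -> : J.+1%:R * (eps / (4 * J.+1%:R)) = eps / 4 by field; rewrite gt_eqF.
lra.
Qed.

End seminorm.
End banach_lattice.

(** * Positive functionals on the cone and moduli *)

Section cone.
Context {R : realType} {E : banachLatticeType R}.
Implicit Types (x y z u : E) (a : E -> R).

(** Nonnegative additive functions on the positive cone, dominated by [C] times
    the norm; values outside of the cone are irrelevant. *)
Definition cone_functional (C : R) a : Prop :=
  [/\ forall x y, 0 <=v x -> 0 <=v y -> a (x + y) = a x + a y,
      forall x, 0 <=v x -> 0 <= a x
    & forall x, 0 <=v x -> a x <= C * `|x| ].

Section cone_functional_theory.
Variables (C : R) (a : E -> R).
Hypothesis ca : cone_functional C a.

Lemma coneD x y : 0 <=v x -> 0 <=v y -> a (x + y) = a x + a y.
Proof. by case: ca => + _ _; apply. Qed.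

Lemma cone_ge0 x : 0 <=v x -> 0 <= a x.
Proof. by case: ca => _ + _; apply. Qed.

Lemma cone_le x : 0 <=v x -> a x <= C * `|x|.
Proof. by case: ca => _ _; apply. Qed.

Lemma coneB x y : 0 <=v x -> x <=v y -> a (y - x) = a y - a x.
Proof.
move=> x0 xy; rewrite -[in RHS](subrK x y) (coneD _ x0) ?vl_subr_ge0//.
by rewrite addrK.
Qed.

Lemma cone_mono x y : 0 <=v x -> x <=v y -> a x <= a y.
Proof.
move=> x0 xy; rewrite -subr_ge0 -coneB//.
by apply: cone_ge0; rewrite vl_subr_ge0.
Qed.

Lemma cone0 : a 0 = 0.
Proof. by have := coneD (vl_lexx 0) (vl_lexx 0); rewrite addr0; lra. Qed.

Lemma cone_sum (I : Type) (s : seq I) (F : I -> E) : (forall i, 0 <=v F i) ->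
  0 <=v \sum_(i <- s) F i /\ a (\sum_(i <- s) F i) = \sum_(i <- s) a (F i).
Proof.
move=> F0; elim: s => [|i s [IH1 IH2]]; first by rewrite !big_nil cone0 vl_lexx.
rewrite !big_cons coneD// IH2; split=> //; exact: vl_addr_ge0.
Qed.

End cone_functional_theory.

Lemma cone_functional_sum (C : nat -> R) (a : nat -> E -> R) (N : nat) :
  (forall n, cone_functional (C n) (a n)) ->
  cone_functional (\sum_(n < N) C n) (fun x => \sum_(n < N) a n x).
Proof.
move=> ca; split=> [x y x0 y0|x x0|x x0].
- by rewrite -big_split; apply: eq_bigr => n _; case: (ca n) => -> .
- by apply: sumr_ge0 => n _; case: (ca n) => _ + _; apply.
- by rewrite mulr_suml; apply: ler_sum => n _; case: (ca n) => _ _; apply.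
Qed.

Lemma dual_pos_le (f : dual E) (C : R) : (forall x, `|f x| <= C * `|x|) ->
  forall x y, 0 <=v x -> vl_abs y <=v x -> 0 <= C -> f y <= C * `|x|.
Proof.
move=> fC x y x0 yx C0; apply: le_trans (ler_norm _) _; apply: le_trans (fC _) _.
by rewrite ler_wpM2l// -vl_norm_abs; apply: vl_norm_le yx; exact: vl_abs_ge0.
Qed.

(** The modulus of a functional, on the positive cone. *)
Definition dual_abs (f : dual E) x : R :=
  sup [set (f y : R) | y in [set y | vl_abs y <=v x]].

Lemma dual_abs_has_sup (f : dual E) x : 0 <=v x ->
  has_sup [set (f y : R) | y in [set y | vl_abs y <=v x]].
Proof.
move=> x0; split; first by exists (f 0), 0 => //=; rewrite vl_abs0.
exists (dual_norm f * `|x|) => _ [y /= yx <-].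
exact: dual_pos_le (ler_dual_norm f) _ _ x0 yx (dual_norm_ge0 f).
Qed.

Lemma dual_abs_ub (f : dual E) x y : 0 <=v x -> vl_abs y <=v x ->
  f y <= dual_abs f x.
Proof. by move=> x0 yx; apply: (sup_upper_bound (dual_abs_has_sup f x0)); exists y. Qed.

Lemma dual_abs_norm_ub (f : dual E) y : `|f y| <= dual_abs f (vl_abs y).
Proof.
rewrite ler_norml lerNl; apply/andP; split; last first.
  by apply: dual_abs_ub; rewrite ?vl_abs_ge0 ?vl_lexx.
rewrite -[X in X <= _](linearN f) dual_abs_ub ?vl_abs_ge0// vl_absN; exact: vl_lexx.
Qed.

Lemma dual_abs_lub (f : dual E) x (c : R) : 0 <=v x ->
  (forall y, vl_abs y <=v x -> f y <= c) -> dual_abs f x <= c.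
Proof.
move=> x0 fc; apply: ge_sup; first by case: (dual_abs_has_sup f x0).
by move=> _ [y /= yx <-]; exact: fc.
Qed.

Lemma dual_abs_adherent (f : dual E) x (c : R) : 0 <=v x -> c < dual_abs f x ->
  exists y, vl_abs y <=v x /\ c < f y.
Proof.
move=> x0 cx; have d0 : 0 < dual_abs f x - c by rewrite subr_gt0.
have [_ [y /= yx <-]] := sup_adherent d0 (dual_abs_has_sup f x0).
by rewrite -/(dual_abs f x) opprB addrC subrK => cy; exists y.
Qed.

Lemma dual_abs_cone (f : dual E) (C : R) : 0 <= C ->
  (forall x, `|f x| <= C * `|x|) -> cone_functional C (dual_abs f).
Proof.
move=> C0 fC; split=> [x y x0 y0|x x0|x x0]; last 2 first.
- by rewrite -(linear0 f) dual_abs_ub// vl_abs0.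
- by apply: dual_abs_lub => // y yx; exact: dual_pos_le.
have xy0 := vl_addr_ge0 x0 y0.
apply: le_anti; apply/andP; split.
  apply: dual_abs_lub => // w /(vl_riesz x0 y0)[w1 [w2 [-> w1x w2y]]].
  by rewrite linearD lerD// dual_abs_ub.
rewrite -lerBrDr; apply: dual_abs_lub => // v vx.
rewrite lerBrDr addrC -lerBrDr; apply: dual_abs_lub => // w wy.
rewrite lerBrDr addrC -[X in X <= _](linearD f).
by apply: dual_abs_ub => //; apply: vl_trans (vl_absD _ _) (vl_leDD _ _).
Qed.

(** The seminorm [x |-> sup_n |f_n|(|x|)]; it is meaningful for bounded
    sequences, for which the supremum is that of a bounded set. *)
Definition dual_seminorm (f : nat -> dual E) x : R :=
  sup (range (fun n => dual_abs (f n) (vl_abs x))).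

(** [f_n (x_k)] tends to [0] with [k], uniformly in [n], for every norm bounded
    disjoint sequence [(x_k)]. *)
Definition disj_unif_null (f : nat -> dual E) : Prop :=
  forall (x : nat -> E) (K : R), disjoint_seq x -> (forall k, `|x k| <= K) ->
  forall eps, 0 < eps ->
    exists N, forall k, (N <= k)%N -> forall n, `|f n (x k)| <= eps.

Section dual_seminorm_theory.
Variables (C : R) (f : nat -> dual E).
Hypotheses (C0 : 0 <= C) (fC : forall n x, `|f n x| <= C * `|x|).

Let fcone n : cone_functional C (dual_abs (f n)).
Proof. exact: dual_abs_cone. Qed.

Let has_supP x : has_sup (range (fun n => dual_abs (f n) (vl_abs x))).
Proof.
split; first by exists (dual_abs (f 0) (vl_abs x)), 0.
exists (C * `|vl_abs x|) => _ [n _ <-].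
exact: (cone_le (fcone n) (vl_abs_ge0 x)).
Qed.

Lemma dual_seminorm_ub n x : dual_abs (f n) (vl_abs x) <= dual_seminorm f x.
Proof. by apply: (sup_upper_bound (has_supP x)); exists n. Qed.

Lemma dual_seminorm_norm_ub n x : `|f n x| <= dual_seminorm f x.
Proof. exact: le_trans (dual_abs_norm_ub _ _) (dual_seminorm_ub n x). Qed.

Lemma dual_seminorm_adherent x (c : R) : c < dual_seminorm f x ->
  exists n, c < dual_abs (f n) (vl_abs x).
Proof.
move=> cx; have d0 : 0 < dual_seminorm f x - c by rewrite subr_gt0.
have [_ [n _ <-]] := sup_adherent d0 (has_supP x).
by rewrite -/(dual_seminorm f x) opprB addrC subrK => cy; exists n.
Qed.

Lemma dual_seminorm_lub x (c : R) :
  (forall n, dual_abs (f n) (vl_abs x) <= c) -> dual_seminorm f x <= c.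
Proof.
move=> fc; apply: ge_sup; first by case: (has_supP x).
by move=> _ [n _ <-].
Qed.

Lemma dual_seminormP : lattice_seminorm C (dual_seminorm f).
Proof.
split=> [x y xy|x y|x]; apply: dual_seminorm_lub => n.
- apply: le_trans (dual_seminorm_ub n y).
  exact: (cone_mono (fcone n)) (vl_abs_ge0 _) xy.
- apply: le_trans (cone_mono (fcone n) (vl_abs_ge0 _) (vl_absD _ _)) _.
  by rewrite (coneD (fcone n)) ?vl_abs_ge0// lerD// dual_seminorm_ub.
- by rewrite -vl_norm_abs; exact: (cone_le (fcone n) (vl_abs_ge0 x)).
Qed.

Lemma disj_unif_null_seminorm : disj_unif_null f -> disj_null (dual_seminorm f).
Proof.
move=> fn x K [x0 xd] xK eps eps0.
(* where the seminorm of [x_k] exceeds [eps], choose [|y_k| <= x_k] that witnesses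
   it; the positive parts of the [y_k], and of the [- y_k], form disjoint sequences *)
have /choice[y yP] k : exists y, vl_abs y <=v x k /\
    (eps < dual_seminorm f (x k) -> exists n, eps < f n y).
  have [h|h] := ltP eps (dual_seminorm f (x k)); last first.
    by exists 0; split; rewrite ?vl_abs0.
  have [n] := dual_seminorm_adherent h; rewrite vl_absE// => hn.
  by have [y [yx yn]] := dual_abs_adherent (x0 k) hn; exists y; split=> // _; exists n.
have [yx _] := all_and2 yP.
have disj (w : nat -> E) : (forall k, vl_pos (w k) <=v x k) ->
    disjoint_seq (fun k => vl_pos (w k)) /\ forall k, `|vl_pos (w k)| <= K.
  move=> wx; split; last first.
    by move=> k; apply: le_trans (xK k); apply: vl_norm_le; rewrite ?vl_pos_ge0.
  split=> [k|k l kl]; first exact: vl_pos_ge0.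
  by apply: vl_disj_mono (xd _ _ kl); rewrite ?vl_pos_ge0.
have [d1 b1] : disjoint_seq (fun k => vl_pos (y k)) /\ forall k, `|vl_pos (y k)| <= K.
  by apply: disj => k; apply: vl_trans (yx k); exact: vl_pos_le_abs.
have [d2 b2] : disjoint_seq (fun k => vl_pos (- y k)) /\
    forall k, `|vl_pos (- y k)| <= K.
  by apply: disj => k; apply: vl_trans (yx k); rewrite -vl_absN; exact: vl_pos_le_abs.
have eps20 : 0 < eps / 2 by rewrite divr_gt0.
have [N1 h1] := fn _ _ d1 b1 _ eps20.
have [N2 h2] := fn _ _ d2 b2 _ eps20.
exists (maxn N1 N2) => k; rewrite geq_max => /andP[N1k N2k].
rewrite leNgt; apply/negP => h; have [_ /(_ h)[n]] := yP k.
apply/negP; rewrite -leNgt -(vl_posB (y k)) linearB /=.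
rewrite [leRHS](splitr eps); apply: lerD.
  by apply: le_trans (ler_norm _) (h1 _ N1k n).
by apply: le_trans (ler_norm _) _; rewrite normrN; exact: h2.
Qed.

Hypothesis fnull : disj_unif_null f.
Let pS := dual_seminormP.
Let pdn := disj_unif_null_seminorm fnull.

Lemma vl_posD_meet (y r w : E) :
  vl_pos (y - vl_meet r w) <=v vl_pos (y - r) + vl_pos (y - w).
Proof.
have p1 := vl_pos_ge0 (y - r); have p2 := vl_pos_ge0 (y - w).
apply: vl_pos_le; last exact: vl_addr_ge0.
rewrite vl_leBlD addrC vl_meetDr; apply: vl_lemeet; rewrite addrC -vl_leBlD.
  by rewrite -[X in X <=v _]addr0; apply: vl_leDD => //; exact: vl_le_pos.
by rewrite -[X in X <=v _]add0r; apply: vl_leDD => //; exact: vl_le_pos.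
Qed.

(** On an order interval, the seminorm is absolutely continuous with respect to
    finitely many of the functionals [|f_n|]. Otherwise there are [y_k] in
    [[0, u]] with [|f_n|(y_k) <= 2^-k] for [n < k] and [p y_k > eps]; a
    [p]-approximation [r_n] of the infimum over [i <= n] of the suprema of
    [(y_k)_{k >= i}] decreases, stays [p]-large, but [|f_i|(r_n)] tends to [0]
    for each [i]. *)
Lemma dual_seminorm_abs_cont u (eps : R) : 0 <=v u -> 0 < eps ->
  exists N d, 0 < d /\ forall y, 0 <=v y -> y <=v u ->
    (forall n, (n < N)%N -> dual_abs (f n) y <= d) -> dual_seminorm f y <= eps.
Proof.
move=> u0 eps0; set p := dual_seminorm f; apply: contrapT => H.
have /choice[y yP] k : exists y, [/\ 0 <=v y, y <=v u,
    forall n, (n < k)%N -> dual_abs (f n) y <= (2^-1) ^+ k & eps < p y].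
  apply: contrapT => Hk; apply: H; exists k, ((2^-1) ^+ k).
  split; first by rewrite exprn_gt0// invr_gt0.
  by move=> y y0 yu yd; rewrite leNgt; apply/negP => py; apply: Hk; exists y.
have y0 k : 0 <=v y k by case: (yP k).
have yu k : y k <=v u by case: (yP k).
pose w n := fix w m : E := if m is m'.+1 then vl_join (w m') (y (n + m)%N) else y n.
have w0 n m : 0 <=v w n m.
  by elim: m => [|m IH] //=; apply: vl_trans IH _; exact: vl_lejl.
have wu n m : vl_abs (w n m) <=v u.
  by rewrite vl_absE//; elim: m => [|m IH] //=; exact: vl_lemjoin.
have wm n i j : (i <= j)%N -> w n i <=v w n j.
  elim: j => [|j IH]; first by rewrite leqn0 => /eqP ->; exact: vl_lexx.
  rewrite leq_eqVlt => /predU1P[->|]; first exact: vl_lexx.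
  by rewrite ltnS => /IH h; apply: vl_trans h _; exact: vl_lejl.
have wy n m : y (n + m)%N <=v w n m.
  by case: m => [|m] /=; rewrite ?addn0 ?vl_lexx//; exact: vl_lejr.
have half0 n : 0 < (2^-1 : R) ^+ n by rewrite exprn_gt0// invr_gt0.
have wa i n m : (i < n)%N ->
    dual_abs (f i) (w n m) <= (2^-1) ^+ n * (2 - (2^-1) ^+ m).
  move=> lin; elim: m => [|m IH] /=.
    by rewrite expr0; have [_ _ /(_ i lin)] := yP n; lra.
  apply: (@le_trans _ _ (dual_abs (f i) (w n m + y (n + m.+1)%N))).
    apply: (cone_mono (fcone i)); first by apply: vl_trans (w0 n m) _; exact: vl_lejl.
    apply: vl_lemjoin.
      by rewrite -[X in X <=v _]addr0; apply: vl_leDD; rewrite ?vl_lexx.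
    by rewrite -[X in X <=v _]add0r; apply: vl_leDD; rewrite ?vl_lexx.
  rewrite (coneD (fcone i))//; apply: le_trans (lerD IH (_ : _ <= (2^-1) ^+ (n + m.+1))) _.
    by have [_ _ + _] := yP (n + m.+1)%N; apply; exact: ltn_addr.
  by rewrite exprD exprS; lra.
have /choice[M MP] n : exists M, forall m, (M <= m)%N ->
    p (w n m - w n M) <= eps / 8 * (2^-1) ^+ n.
  apply: (disj_null_monotone pS pdn u0 (wu n) (wm n)).
  by rewrite mulr_gt0// divr_gt0.
pose W n := w n (M n).
pose r := fix r n : E := if n is n'.+1 then vl_meet (r n') (W n) else W 0%N.
have r0 n : 0 <=v r n.
  by elim: n => [|n IH] /=; [exact: w0|apply: vl_meet_ge0 => //; exact: w0].
have rW n : r n <=v W n by case: n => [|n] /=; rewrite ?vl_lexx// vl_lem_r.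
have rm i j : (i <= j)%N -> r j <=v r i.
  elim: j => [|j IH]; first by rewrite leqn0 => /eqP ->; exact: vl_lexx.
  rewrite leq_eqVlt => /predU1P[->|]; first exact: vl_lexx.
  by rewrite ltnS => /IH h; apply: vl_trans h; exact: vl_lem_l.
have [pm pD pC] := pS.
have yW i n : (i <= n)%N -> p (vl_pos (y n - W i)) <= eps / 8 * (2^-1) ^+ i.
  move=> lin; apply: le_trans (MP i (maxn (M i) (n - i)%N) (leq_maxl _ _)).
  have h : w i (M i) <=v w i (maxn (M i) (n - i)%N) by rewrite wm// leq_maxl.
  apply: (seminorm_mono pS); first exact: vl_pos_ge0.
  apply: vl_pos_le; last by rewrite vl_subr_ge0.
  apply: vl_leDr; apply: vl_trans (wm i _ _ (leq_maxr _ _)).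
  by have := wy i (n - i)%N; rewrite subnKC.
have yr n j : (j <= n)%N -> p (vl_pos (y n - r j)) <= eps / 8 * (2 - (2^-1) ^+ j).
  elim: j => [|j IH] jn /=.
    by apply: le_trans (yW 0%N n _) _ => //; rewrite expr0; lra.
  apply: le_trans (seminorm_mono pS (vl_pos_ge0 _) (vl_posD_meet _ _ _)) _.
  apply: le_trans (pD _ _) _.
  apply: le_trans (lerD (IH (ltnW jn)) (yW j.+1 n jn)) _.
  by rewrite exprS; have := half0 j; lra.
have pr n : eps * 3 / 4 < p (r n).
  have [_ _ _ py] := yP n.
  have : p (y n) <= p (vl_pos (y n - r n)) + p (r n).
    apply: le_trans (pD _ _); apply: (seminorm_mono pS) => //.
    by rewrite -vl_leBlD vl_le_pos.
  have := yr n n (leqnn n); have := mulr_gt0 eps0 (half0 n); lra.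
have ru n : vl_abs (- r n) <=v u.
  by rewrite vl_absN vl_absE//; apply: vl_trans (rW n) _; rewrite -[W n]vl_absE ?wu//; exact: w0.
have rmN i j : (i <= j)%N -> - r i <=v - r j by move=> ij; rewrite vl_leN rm.
have [N NP] := disj_null_monotone pS pdn u0 ru rmN (divr_gt0 eps0 (ltr0n _ 4)).
have := pr N; rewrite -/p => /dual_seminorm_adherent[i]; rewrite vl_absE// => hi.
have [N2 hN2] := exp2N_small 2 (divr_gt0 eps0 (ltr0n _ 4)).
pose n := (N + i.+1 + N2)%N.
have Nn : (N <= n)%N by rewrite /n -addnA leq_addr.
have inn : (i < n)%N by rewrite /n -addnA addnCA leq_addr.
have h1 : dual_abs (f i) (r N) - dual_abs (f i) (r n) <= eps / 4.
  rewrite -(coneB (fcone i))// ?rm//.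
  apply: le_trans (NP n Nn); have -> : - r n - - r N = r N - r n by lmodule R E.
  have rn : 0 <=v r N - r n by rewrite vl_subr_ge0 rm.
  by have := dual_seminorm_ub i (r N - r n); rewrite vl_absE.
have h2 : dual_abs (f i) (r n) <= eps / 4.
  apply: le_trans (cone_mono (fcone i) (r0 n) (rW n)) _.
  apply: le_trans (wa i n (M n) inn) _; apply: le_trans (hN2 n _); last by rewrite leq_addl.
  by rewrite mulrC ler_wpM2r ?ltW//; have := half0 (M n); lra.
lra.
Qed.

End dual_seminorm_theory.
End cone.

(** * Iterated limits against disjointly null sequences of functionals *)

(** The vectors obtained from [z_k, .., z_(m-1)] by iterated midpoints. *)
Inductive mid_hull (R : realType) (E : lmodType R) (z : nat -> E) (k m : nat) :
    E -> Prop :=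
  | mid_hull_base j : (k <= j)%N -> (j < m)%N -> mid_hull z k m (z j)
  | mid_hull_mid x y : mid_hull z k m x -> mid_hull z k m y ->
      mid_hull z k m (2^-1 *: (x + y)).

Section iterated_limits.
Context {R : realType} {E : banachLatticeType R}.
Implicit Types (x y u : E) (z : nat -> E).

Lemma mid_hull_sub z k m k' m' x : (k' <= k)%N -> (m <= m')%N ->
  mid_hull z k m x -> mid_hull z k' m' x.
Proof.
move=> kk mm; elim=> [j kj jm|a b _ IHa _ IHb]; last exact: mid_hull_mid.
by apply: mid_hull_base; [exact: leq_trans kj|exact: leq_trans mm].
Qed.

Lemma mid_hull_abs_le z k m u x : (forall j, vl_abs (z j) <=v u) ->
  mid_hull z k m x -> vl_abs x <=v u.
Proof.
move=> zu; elim=> // a b _ IHa _ IHb; rewrite vl_absZ ?invr_ge0//.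
have -> : u = 2^-1 *: (u + u) by lmodule R E.
apply: vl_leZr; rewrite ?invr_ge0//; apply: vl_trans (vl_absD _ _) _.
exact: vl_leDD.
Qed.

Lemma mid_hull_dist (f : dual E) z k m x (a d : R) :
  (forall j, (k <= j)%N -> (j < m)%N -> `|f (z j) - a| <= d) ->
  mid_hull z k m x -> `|f x - a| <= d.
Proof.
have aux (s t : R) : `|s - a| <= d -> `|t - a| <= d -> `|2^-1 * (s + t) - a| <= d.
  by rewrite !ler_norml => /andP[? ?] /andP[? ?]; apply/andP; split; lra.
move=> fz; elim=> [j|b c _ IHb _ IHc]; first exact: fz.
by rewrite linearZ linearD; exact: aux.
Qed.

(** In an order interval every sequence has two successive blocks with midpoint
    combinations that are close for a given positive functional [G]. The sum over
    a grid of levels [c] of [G |x - c|] is a uniformly convex substitute for the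
    square of a Hilbert norm: it is nearly minimal at both combinations, hence
    the slices of their difference are small. *)
Lemma mid_hull_close (C : R) (G : E -> R) z u (d : R) : cone_functional C G ->
  0 <= C -> 0 <=v u -> (forall j, vl_abs (z j) <=v u) -> 0 < d ->
  exists k m m' y y', [/\ mid_hull z k m y, mid_hull z m m' y'
    & G (vl_abs (y - y')) <= d].
Proof.
move=> cG C0 u0 zu d0.
pose h : R := d / (4 * (C * `|u| + 1)).
have den : 0 < C * `|u| + 1 by rewrite ltr_wpDl// mulr_ge0.
have h0 : 0 < h by rewrite divr_gt0// mulr_gt0.
have [J hJ] : exists J : nat, 2 <= h * J%:R.
  exists (Num.truncn (2 / h)).+1; rewrite mulrC -ler_pdivrMr//.
  by apply: ltW; rewrite truncnS_gt.
pose c (j : nat) := (h * j%:R - 1) *: u.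
pose q x := \sum_(0 <= j < J.+1) G (vl_abs (x - c j)).
have q0 x : 0 <= q x by apply: sumr_ge0 => j _; exact: (cone_ge0 cG) (vl_abs_ge0 _).
pose B := \sum_(0 <= j < J.+1) C * (`|u| + `|c j|).
have qB x : vl_abs x <=v u -> q x <= B.
  move=> xu; apply: ler_sum => j _; apply: le_trans (cone_le cG (vl_abs_ge0 _)) _.
  rewrite ler_wpM2l// vl_norm_abs; apply: le_trans (ler_normB _ _) _.
  by rewrite lerD2r -(vl_norm_abs x); exact: vl_norm_le (vl_abs_ge0 _) xu.
pose H k := [set x | exists m, mid_hull z k m x].
have Hz k : H k (z k) by exists k.+1; apply: mid_hull_base.
have Hu k x : H k x -> vl_abs x <=v u by case=> m; exact: mid_hull_abs_le.
pose I k := inf [set q x | x in H k].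
have infP k : has_inf [set q x | x in H k].
  by split; [exists (q (z k)), (z k)|exists 0 => _ [x _ <-]].
have Ile k x : H k x -> I k <= q x.
  by move=> Hx; apply: (inf_lbound (proj2 (infP k))); exists x.
have supI : has_sup (range I).
  split; first by exists (I 0%N), 0%N.
  exists B => _ [k _ <-]; apply: le_trans (Ile _ _ (Hz k)) _.
  exact: qB.
have e0 : 0 < d / 8 by rewrite divr_gt0.
have [_ [k _ <-] hk] := sup_adherent e0 supI.
have Isup l : I l <= I k + d / 8.
  have := sup_upper_bound supI (ex_intro2 _ _ l Logic.I erefl); lra.
have [_ [y [m ym] <-] qy] := inf_adherent e0 (infP k).
have [_ [y' [m' ym'] <-] qy'] := inf_adherent e0 (infP (maxn k m)).
exists k, (maxn k m), m', y, y'; split=> //.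
  by apply: mid_hull_sub ym; rewrite ?leq_maxr.
have yu := Hu k y (ex_intro _ m ym).
have yu' := Hu _ y' (ex_intro _ m' ym').
have midH : H k (2^-1 *: (y + y')).
  exists (maxn m m'); apply: mid_hull_mid.
    by apply: mid_hull_sub ym; rewrite ?leq_maxl.
  by apply: mid_hull_sub ym'; rewrite ?leq_maxl ?leq_maxr.
have qmid := Ile _ _ midH.
have qI' := Isup (maxn k m).
have G2 x : 0 <=v x -> G (2 *: x) = 2 * G x.
  move=> x0; have -> : 2 *: x = x + x by lmodule R E.
  by rewrite (coneD cG)//; lra.
have slE j : G (vl_slice y y' (c j)) =
    G (vl_abs (y - c j)) + G (vl_abs (y' - c j)) - 2 * G (vl_abs (2^-1 *: (y + y') - c j)).
  rewrite -(coneD cG) ?vl_abs_ge0// -G2 ?vl_abs_ge0// -vl_absZ//.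
  have -> : 2 *: (2^-1 *: (y + y') - c j) = y + y' - 2 *: c j by lmodule R E.
  rewrite -(coneB cG) ?vl_abs_ge0//.
  by rewrite -vl_subr_ge0; exact: vl_slice_ge0.
have [sum0 sumE] := cone_sum cG (index_iota 0 J.+1) (fun j => vl_slice_ge0 y y' (c j)).
have hu0 : 0 <=v h *: u by apply: vl_scaler_ge0; rewrite ?ltW.
apply: le_trans (cone_mono cG (vl_abs_ge0 _) (vl_grid u0 h0 hJ yu yu')) _.
rewrite (coneD cG)// sumE (eq_bigr _ (fun j _ => slE j)) sumrB big_split /=.
rewrite -mulr_sumr -/(q y) -/(q y') -/(q (2^-1 *: (y + y'))).
have Ghu : G (h *: u) <= d / 4.
  apply: le_trans (cone_le cG hu0) _; rewrite normrZ gtr0_norm//.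
  rewrite /h mulrCA -ler_pdivlMl ?divr_gt0 ?mulr_gt0//.
  have -> : (d / (4 * (C * `|u| + 1)))^-1 * (d / 4) = C * `|u| + 1.
    by field; rewrite !gt_eqF.
  by rewrite lerDl.
rewrite -/(I k) in qy; rewrite -/(I (maxn k m)) in qy'.
lra.
Qed.

(** Grothendieck's double limit condition: were [a] and [b] far apart, so would be
    the values of some [f_m] at combinations of the [z_k] with [k < m] and with
    [k >= m], although two such combinations are uniformly close on [(f_n)]. *)
Lemma disj_unif_null_iterated (f : nat -> dual E) z (C K a b eps : R) :
  0 <= C -> (forall n x, `|f n x| <= C * `|x|) -> disj_unif_null f ->
  (forall k, `|z k| <= K) -> 0 < eps ->
  (forall n k, (n <= k)%N -> `|f n (z k) - a| <= eps) ->
  (forall n k, (k < n)%N -> `|f n (z k) - b| <= eps) ->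
  `|a - b| <= 5 * eps.
Proof.
move=> C0 fC fnull zK eps0 fa fb.
have pS := dual_seminormP C0 fC.
have pdn := disj_unif_null_seminorm C0 fC fnull.
have [u [u0 uP]] := disj_null_order_bound pS K pdn eps0.
pose z' k := vl_trunc u (z k).
have z'u k : vl_abs (z' k) <=v u by exact: vl_abs_trunc.
have zz n k : `|f n (z k) - f n (z' k)| <= eps.
  rewrite -[X in `|X|](linearB (f n)).
  apply: le_trans (dual_seminorm_norm_ub C0 fC n _) _.
  apply: le_trans (uP _ (zK k)); rewrite -(seminorm_abs pS).
  by apply: (seminorm_mono pS); [exact: vl_abs_ge0|exact: vl_trunc_dist].
have dist n k (e : R) : `|f n (z k) - e| <= eps -> `|f n (z' k) - e| <= 2 * eps.
  move=> h; have -> : f n (z' k) - e = (f n (z k) - e) - (f n (z k) - f n (z' k)) :> R by ring.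
  by apply: le_trans (ler_normB _ _) _; have := zz n k; lra.
have uu0 : 0 <=v u + u by exact: vl_addr_ge0.
have [N [d [d0 hN]]] := dual_seminorm_abs_cont C0 fC fnull uu0 eps0.
have cG := cone_functional_sum N (fun n => dual_abs_cone C0 (fC n)).
have CN0 : 0 <= \sum_(n < N) C by apply: sumr_ge0.
have [k [m [m' [y [y' [yk ym Gyy]]]]]] := mid_hull_close cG CN0 u0 z'u d0.
have yy : dual_seminorm f (y - y') <= eps.
  rewrite -(seminorm_abs pS); apply: hN.
  - exact: vl_abs_ge0.
  - apply: vl_trans (vl_absD _ _) _; rewrite vl_absN; apply: vl_leDD.
      exact: mid_hull_abs_le z'u yk.
    exact: mid_hull_abs_le z'u ym.
  move=> n nN; apply: le_trans Gyy.
  rewrite (bigD1 (Ordinal nN)) //= lerDl; apply: sumr_ge0 => i _.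
  exact: (cone_ge0 (dual_abs_cone C0 (fC i)) (vl_abs_ge0 (y - y'))).
have h1 : `|f m y - b| <= 2 * eps.
  by apply: mid_hull_dist yk => j _ jm; apply: dist; exact: fb.
have h2 : `|f m y' - a| <= 2 * eps.
  by apply: mid_hull_dist ym => j mj _; apply: dist; exact: fa.
have h3 : `|f m y - f m y'| <= eps.
  rewrite -[X in `|X|](linearB (f m)).
  exact: le_trans (dual_seminorm_norm_ub C0 fC m _) yy.
have -> : a - b = (f m y - b) - (f m y - f m y') - (f m y' - a) :> R by ring.
apply: le_trans (ler_normB _ _) _; apply: le_trans (lerD (ler_normB _ _) (lexx _)) _.
lra.
Qed.

End iterated_limits.

(** * Duality *)

Section duality.
Context {R : realType}.
Implicit Types X : normedModType R.

Lemma linear_le_continuous X (Y : normedModType R) (g : X -> Y) (C : R) :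
  linear g -> (forall x, `|g x| <= C * `|x|) -> continuous g.
Proof.
move=> lg gC x; apply/cvgrPdist_le => e e0.
have C0 : 0 < `|C| + 1 by rewrite ltr_wpDl.
near=> y.
have gxy : g x - g y = g (x - y).
  have -> : x - y = -1 *: y + x by lmodule R X.
  by rewrite lg scaleN1r addrC.
rewrite gxy; apply: le_trans (gC _) _.
apply: (@le_trans _ _ ((`|C| + 1) * `|x - y|)).
  by rewrite ler_wpM2r// (le_trans (ler_norm _))// lerDl.
rewrite mulrC -ler_pdivlMr//; near: y.
by apply: cvgr_dist_le => //; rewrite divr_gt0.
Unshelve. all: by end_near. Qed.

Lemma dual_exists X (g : X -> R^o) (C : R) : linear g ->
  (forall x, `|g x| <= C * `|x|) -> exists f : dual X, forall x, f x = g x.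
Proof.
move=> lg gC.
have gP : g \in @dual_pred R X.
  by apply/asboolP; split=> //; exact: linear_le_continuous lg gC.
by exists (Dual gP).
Qed.

Lemma dual_ext X (f g : dual X) : (forall x, f x = g x) -> f = g.
Proof. by move=> fg; apply: val_inj; apply/funext. Qed.

Lemma dual_norm_ub X (f : dual X) x : `|f x| <= `|f| * `|x|.
Proof. exact: ler_dual_norm. Qed.

(** The canonical image of a vector in the bidual. *)
Lemma bidual_eval X (x : X) : exists phi : dual (dual X), forall f : dual X, phi f = f x.
Proof.
apply: (@dual_exists (dual X) (fun f => f x) `|x|) => // f.
by rewrite mulrC; exact: dual_norm_ub.
Qed.

(** ** Weak convergence *)

Lemma cvg_initial_ptwsP (S : choiceType) (I : topologicalType) (e : S -> {ptws I -> R})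
    (F : set_system S) (s : S) : Filter F ->
  F --> (s : initial_topology e) <->
  forall i, e t i @[t --> F] --> e s i.
Proof.
move=> FF; apply: iff_trans (pointwise_cvgP (e s) (fmap_filter e FF)).
split=> h.
  apply: (cvg_trans _ (@initial_continuous _ _ e s)).
  by move=> A; exact: h.
move=> A /= [B [[C Cop CB] Bs BA]]; rewrite -CB in Bs BA.
have /h : nbhs (e s : {ptws I -> R}) C.
  by apply: (@open_nbhs_nbhs {ptws I -> R}); split.
by move=> FC; exact: (@filterS _ F FF _ _ BA FC).
Qed.

Lemma weak_filter_cvgP X (F : set_system X) (l : X) : Filter F ->
  F --> (l : weak X) <-> forall f : dual X, f x @[x --> F] --> (f l : R).
Proof. move=> FF; exact: (@cvg_initial_ptwsP X (dual X)). Qed.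

Lemma weak_cvgP X (x : nat -> X) (l : X) :
  weak_cvg x l <-> forall f : dual X, f (x n) @[n --> \oo] --> (f l : R).
Proof. exact: (@weak_filter_cvgP X (x @ \oo)). Qed.

Lemma weak_star_cvgP X (f : nat -> dual X) (g : dual X) :
  weak_star_cvg f g <-> forall x, f n x @[n --> \oo] --> (g x : R).
Proof. exact: (@cvg_initial_ptwsP (dual X) X _ (f @ \oo)). Qed.

Lemma weak_hausdorff X : (forall x y : X, (forall f : dual X, f x = f y) -> x = y) ->
  hausdorff_space (weak X).
Proof.
move=> sep p q; rewrite cluster_cvgE => -[G GF [Gq pG]].
apply: sep => f; apply: (@cvg_unique R (@Rhausdorff R) (f @ G)).
- exact: (proj1 (weak_filter_cvgP p _) pG f).
- exact: (proj1 (weak_filter_cvgP q _) Gq f).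
Qed.

(** ** Limits along ultrafilters *)

Lemma ultra_bounded_cvg (T : Type) (U : set_system T) (b : T -> R) (M : R) :
  UltraFilter U -> (\forall t \near U, `|b t| <= M) ->
  exists l : R, b t @[t --> U] --> l.
Proof.
move=> UU bM.
have cpt : compact `[- M, M]%classic by exact: segment_compact.
have [l [_ bl]] : `[- M, M]%classic `&` cluster (b @ U) !=set0.
  apply: cpt; apply: filterS bM => t /=; rewrite in_itv /= ler_norml => ->//.
exists l => A Al; have [//|nA] := in_ultra_setVsetC (b @^-1` A) UU.
have [r [/=]] := bl (~` A) A nA Al; by move=> h /h.
Qed.

Lemma cvg_norm_ub (T : Type) (U : set_system T) (b : T -> R) (l c : R) :
  ProperFilter U -> b t @[t --> U] --> l -> (\forall t \near U, `|b t| <= c) ->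
  `|l| <= c.
Proof.
move=> UU bl bc; apply/ler_addgt0Pr => e e0.
have /cvgrPdist_le/(_ _ e0) ble := bl.
have [t [le be]] := @filter_ex _ U UU _ (@filterI _ U _ _ _ ble bc).
by rewrite -[l](subrK (b t)) addrC; apply: le_trans (ler_normD _ _) _; exact: lerD.
Qed.

(** Pointwise limits of bounded functionals along an ultrafilter: the
    Banach-Alaoglu theorem. *)
Lemma dual_ultra_limit X (T : Type) (U : set_system T) (h : T -> dual X) (C : R) :
  UltraFilter U -> (\forall t \near U, forall x, `|h t x| <= C * `|x|) ->
  exists f : dual X, (forall x, `|f x| <= C * `|x|) /\
    forall x, h t x @[t --> U] --> (f x : R).
Proof.
move=> UU hC.
have hx x : \forall t \near U, `|h t x : R| <= C * `|x|.
  by apply: filterS hC => t; exact.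
have /choice[g gP] x : exists l : R, h t x @[t --> U] --> l.
  exact: ultra_bounded_cvg (hx x).
have gl : linear (g : X -> R^o).
  move=> a x y; apply: (@cvg_unique R (@Rhausdorff R) (h t (a *: x + y) @[t --> U])).
    exact: gP.
  have -> : (fun t => h t (a *: x + y)) = (fun t => a * (h t x : R) + h t y).
    by apply/funext => t; rewrite linearD linearZ.
  by apply: cvgD; [apply: cvgMr; exact: gP|exact: gP].
have gC x : `|g x| <= C * `|x| by exact: cvg_norm_ub (gP x) (hx x).
have [f fg] := dual_exists gl gC.
by exists f; split=> x; rewrite fg.
Qed.

(** ** Helly's theorem *)

(** A bidual element bounded by [C] agrees approximately, on finitely many
    functionals, with a vector of norm at most [C]. A near-minimizer [z] of the
    sum of the squares [(phi f - f z)^2] over a ball works: first-order variation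
    bounds the norm of the functional [\sum_f (phi f - f z) f]. *)
Lemma helly X (phi : dual (dual X)) (C : R) (l : seq (dual X)) (eps : R) :
  0 < C -> (forall f, `|phi f| <= C * `|f|) -> 0 < eps ->
  exists z : X, `|z| <= C /\ forall f, f \in l -> `|phi f - f z| <= eps.
Proof.
move=> C0 phiC eps0.
pose r z (f : dual X) : R := phi f - f z.
pose Q z := \sum_(f <- l) (r z f) ^+ 2.
pose B := [set z : X | `|z| <= C].
have B0 : B 0 by rewrite /B /= normr0 ltW.
have Q0 z : 0 <= Q z by apply: sumr_ge0 => f _; exact: sqr_ge0.
have infQ : has_inf [set Q z | z in B].
  by split; [exists (Q 0), 0|exists 0 => _ [z _ <-]].
pose m := inf [set Q z | z in B].
have mle z : B z -> m <= Q z by move=> Bz; apply: (inf_lbound (proj2 infQ)); exists z.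
have m0 : 0 <= m by apply: lb_le_inf; [exact: (proj1 infQ)|move=> _ [z _ <-]].
have phiD : exists D, 0 < D /\ forall z w, B z -> B w ->
    \sum_(f <- l) (f w - f z : R) ^+ 2 <= D.
  exists (\sum_(f <- l) (2 * C * `|f|) ^+ 2 + 1); split.
    by rewrite ltr_wpDl//; apply: sumr_ge0 => f _; exact: sqr_ge0.
  move=> z w Bz Bw; apply: ler_wpDr => //; apply: ler_sum => f _.
  rewrite -[X in X <= _]real_normK ?num_real// ler_sqr ?nnegrE ?mulr_ge0 ?(ltW C0)//.
  apply: le_trans (ler_normB _ _) _.
  have := dual_norm_ub f z; have := dual_norm_ub f w.
  have := ler_wpM2l (normr_ge0 f) Bz; have := ler_wpM2l (normr_ge0 f) Bw.
  set s := `|f w|; set t := `|f z|.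
  lra.
have [D [D0 DP]] := phiD.
suff : m < eps ^+ 2.
  move=> meps; have d0 : 0 < eps ^+ 2 - m by rewrite subr_gt0.
  have [_ [z Bz <-]] := inf_adherent d0 infQ.
  rewrite -/m addrC subrK => Qz; exists z; split=> // f fl.
  rewrite -ler_sqr ?nnegrE ?(ltW eps0)// real_normK ?num_real//.
  apply: le_trans (ltW Qz); rewrite /Q (big_rem f)//= lerDl.
  by apply: sumr_ge0 => g _; exact: sqr_ge0.
apply: contrapT => /negP; rewrite -leNgt => epsm.
have mpos : 0 < m by apply: lt_le_trans epsm; rewrite exprn_gt0.
(* Moving from [z] towards [w] by the step [t] changes [Q] by
   [- 2 t A w + O(t^2 D)]. The step is such that [t * D <= m / 2], and [z] is taken
   within [t * m / 4] of the infimum. *)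
pose t : R := m / (m + 2 * D).
have den : 0 < m + 2 * D by rewrite addr_gt0// mulr_gt0.
have t0 : 0 < t by rewrite divr_gt0.
have t1 : t <= 1 by rewrite ler_pdivrMr// mul1r lerDl mulr_ge0// ltW.
have tD : t * D <= m / 2.
  rewrite /t mulrAC ler_pdivrMr//.
  have := mulr_gt0 mpos mpos; nra.
clearbody t.
have d0 : 0 < t * m / 4 by rewrite divr_gt0// mulr_gt0.
have [_ [z Bz <-]] := inf_adherent d0 infQ; rewrite -/m => Qz.
pose A w := \sum_(f <- l) r z f * (f w - f z : R).
have Aw w : B w -> A w <= m / 2 - m / 8.
  move=> Bw; pose v := z + t *: (w - z).
  have Bv : B v.
    rewrite /B /= /v; have -> : z + t *: (w - z) = (1 - t) *: z + t *: w by lmodule R X.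
    apply: le_trans (ler_normD _ _) _; rewrite !normrZ.
    rewrite (ger0_norm (ltW t0)) (@ger0_norm _ (1 - t)) ?subr_ge0//.
    have h1 : (1 - t) * `|z| <= (1 - t) * C by rewrite ler_wpM2l// subr_ge0.
    have h2 : t * `|w| <= t * C by rewrite ler_wpM2l// ltW.
    by apply: le_trans (lerD h1 h2) _; rewrite -mulrDl subrK mul1r.
  have := mle v Bv.
  have -> : Q v = Q z - 2 * t * A w + t ^+ 2 * \sum_(f <- l) (f w - f z : R) ^+ 2.
    rewrite /Q /A !mulr_sumr -sumrB -big_split; apply: eq_bigr => f _ /=.
    rewrite /r /v linearD linearZ linearB /=.
    rewrite -[t *: _]/(t * (f w - f z)); set p : R := phi f; set a : R := f z; set b : R := f w.
    by rewrite -[a + _]/(a + t * (b - a))%R; ring.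
  have h3 := DP z w Bz Bw; set Sw := \sum_(f <- l) (f w - f z : R) ^+ 2 in h3 *.
  have h4 : t ^+ 2 * Sw <= t ^+ 2 * D by rewrite ler_wpM2l// sqr_ge0.
  have h5 : t * (t * D) <= t * (m / 2) by rewrite ler_wpM2l// ltW.
  rewrite expr2 in h4 *; move=> h6.
  have h7 : 0 <= t * (m / 4 + m / 2 - 2 * A w) by nra.
  rewrite pmulr_rge0// in h7; lra.
pose H : dual X := \sum_(f <- l) r z f *: f.
have HE w : H w = \sum_(f <- l) r z f * (f w : R) :> R.
  have sumE (s : seq (dual X)) (c : dual X -> R) :
      (\sum_(f <- s) c f *: f) w = \sum_(f <- s) c f * (f w : R) :> R.
    by elim: s => [|f s IH]; rewrite ?big_nil// !big_cons -IH.
  exact: sumE.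
have phiH : phi H = \sum_(f <- l) r z f * (phi f : R) :> R.
  rewrite /H linear_sum /=; apply: eq_bigr => f _; by rewrite linearZ.
have Hw w : B w -> H w <= H z + (m / 2 - m / 8) :> R.
  move=> /Aw; rewrite /A.
  under eq_bigr do rewrite mulrBr.
  by rewrite sumrB -!HE; lra.
have Hnorm : C * `|H| <= H z + (m / 2 - m / 8) :> R.
  rewrite mulrC -ler_pdivlMr//; apply: dual_norm_le => x x1.
  rewrite ler_pdivlMr//.
  have Cx : B (C *: x).
    rewrite /B /= normrZ gtr0_norm//; apply: le_trans (ler_wpM2l (ltW C0) x1) _.
    by rewrite mulr1.
  have Cx' : B (- (C *: x)) by rewrite /B /= normrN.
  have -> : `|H x| * C = `|H (C *: x)| :> R.
    by rewrite linearZ /= normrM gtr0_norm// mulrC.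
  rewrite ler_norml; apply/andP; split; last exact: Hw.
  by have := Hw _ Cx'; rewrite linearN /=; lra.
have := phiC H; rewrite phiH => hphi.
have : \sum_(f <- l) r z f * (phi f : R) - H z = Q z.
  rewrite HE -sumrB; apply: eq_bigr => f _; rewrite -mulrBr /r expr2 //.
have := mle z Bz; move: (ler_norm (\sum_(f <- l) r z f * (phi f : R))) hphi Hnorm.
set S1 := \sum_(f <- l) _; set S2 : R := H z; lra.
Qed.

End duality.

(** * The space of null sequences *)

Section c0_space.
Context {R : realType}.

Definition c0_pred : {pred (nat -> R^o)} := fun c => `[< c @ \oo --> (0 : R^o) >].

(** The real sequences that tend to [0], with the supremum norm. *)
Record c0 := C0 {c0_val :> nat -> R^o ; _ : c0_val \in c0_pred}.

HB.instance Definition _ := [isSub for c0_val].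
HB.instance Definition _ := [Choice of c0 by <:].

Fact c0_submod_closed : submod_closed c0_pred.
Proof.
split=> [|a c d]; first by apply/asboolP; exact: cvg_cst.
move=> /asboolP c_0 /asboolP d_0; apply/asboolP.
rewrite -[X in _ --> X](addr0 0) -[X in _ --> X + _](scaler0 _ a).
by apply: cvgD => //; exact: cvgZl_tmp.
Qed.

HB.instance Definition _ :=
  GRing.isSubmodClosed.Build R (nat -> R^o) c0_pred c0_submod_closed.
HB.instance Definition _ := [SubChoice_isSubLmodule of c0 by <:].

Implicit Types c d : c0.

Fact c0_cvg c : c n @[n --> \oo] --> (0 : R).
Proof. by case: c => c /= /asboolP. Qed.

Definition c0_norm c : R := sup (range (fun n => `|c n|)).

Fact c0_norm_has_sup c : has_sup (range (fun n => `|c n|)).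
Proof.
split; first by exists `|c 0%N|, 0%N.
have /cvg_seq_bounded/ex_strict_bound_gt0[M _ cM] : cvgn (c : nat -> R^o).
  by apply/cvg_ex; exists 0; exact: c0_cvg.
by exists M => _ [n _ <-]; exact: ltW (cM n Logic.I).
Qed.

Fact c0_norm_ub c n : `|c n| <= c0_norm c.
Proof. by apply: (sup_upper_bound (c0_norm_has_sup c)); exists n. Qed.

Fact c0_norm_le c (M : R) : (forall n, `|c n| <= M) -> c0_norm c <= M.
Proof.
move=> cM; apply: ge_sup; first by case: (c0_norm_has_sup c).
by move=> _ [n _ <-].
Qed.

Fact c0_normD c d : c0_norm (c + d) <= c0_norm c + c0_norm d.
Proof.
apply: c0_norm_le => n; apply: le_trans (ler_normD _ _) _.
by apply: lerD; exact: c0_norm_ub.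
Qed.

Fact c0_normZ (a : R) c : c0_norm (a *: c) = `|a| * c0_norm c.
Proof.
have leZ b d : c0_norm (b *: d) <= `|b| * c0_norm d.
  apply: c0_norm_le => n; rewrite [leLHS]normrM.
  by apply: ler_wpM2l => //; exact: c0_norm_ub.
apply/eqP; rewrite eq_le leZ/=.
have [->|a0] := eqVneq a 0.
  rewrite normr0 mul0r; apply: le_trans (c0_norm_ub _ 0%N); exact: normr_ge0.
rewrite -ler_pdivlMl ?normr_gt0// -normfV.
by apply: le_trans (leZ _ _); rewrite scalerA mulVf// scale1r.
Qed.

Fact c0_norm0_eq0 c : c0_norm c = 0 -> c = 0.
Proof.
move=> c_0; apply: val_inj; apply/funext => n /=; apply/eqP.
by rewrite -normr_le0 -c_0 c0_norm_ub.
Qed.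

HB.instance Definition _ :=
  Lmodule_isNormed.Build R c0 c0_normD c0_normZ c0_norm0_eq0.

Lemma c0_coord_ub c n : `|c n| <= `|c|. Proof. exact: c0_norm_ub. Qed.

Lemma c0_exists (g : nat -> R) : g n @[n --> \oo] --> (0 : R) ->
  exists c, forall n, c n = g n.
Proof.
move=> g0; have gP : (g : nat -> R^o) \in c0_pred by exact/asboolP.
by exists (C0 gP).
Qed.

Fact c0_complete (F : set_system c0) : ProperFilter F -> cauchy F -> cvg F.
Proof.
move=> FF /cauchyP Fc.
have [U [UU FU]] := ultraFilterLemma FF.
have Fball e : 0 < e -> exists x : c0, F [set c | `|x - c| < e].
  by move=> e0; have [x Fx] := Fc e e0; exists x; rewrite -ball_normE in Fx.
have /choice[L UL] n : exists l : R, (fun c : c0 => c n : R) @ U --> l.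
  have [x Fx] := Fball 1 ltr01.
  suff h : F [set c | `|c n| <= `|x n| + 1] by exact: ultra_bounded_cvg UU (FU _ h).
  apply: filterS Fx => c /= xc; have -> : c n = x n - (x - c) n :> R.
    by rewrite -[(x - c) n]/(x n - c n); rewrite subKr.
  apply: le_trans (ler_normB _ _) _; rewrite lerD2l.
  exact: le_trans (c0_coord_ub (x - c) n) (ltW xc).
have xL e : 0 < e -> exists x : c0, F [set c | `|x - c| < e] /\
    forall n, `|x n - L n| <= e.
  move=> e0; have [x Fx] := Fball e e0; exists x; split=> // n.
  apply: (@cvg_norm_ub _ _ U (fun c => x n - c n)).
    by apply: cvgB; [exact: cvg_cst|exact: UL].
  suff h : F [set c | `|x n - c n| <= e] by exact: (FU _ h).
  apply: filterS Fx => c /= xc.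
  exact: le_trans (c0_coord_ub (x - c) n) (ltW xc).
have L0 : L n @[n --> \oo] --> (0 : R).
  apply/cvgrPdist_le => e e0; have e20 : 0 < e / 2 by rewrite divr_gt0.
  have [x [_ xL2]] := xL _ e20; have /cvgrPdist_le/(_ _ e20) := c0_cvg x.
  apply: filterS => n; rewrite !sub0r !normrN => xn.
  have -> : L n = x n - (x n - L n) :> R by rewrite subKr.
  by apply: le_trans (ler_normB _ _) _; rewrite (splitr e) lerD.
have [l lL] := c0_exists L0.
apply/cvg_ex; exists l; apply/cvgrPdist_le => e e0.
have e20 : 0 < e / 2 by rewrite divr_gt0.
have [x [Fx xL2]] := xL _ e20.
apply: filterS Fx => c /= xc.
have -> : l - c = (x - c) - (x - l) by lmodule R c0.
apply: le_trans (ler_normB _ _) _; rewrite (splitr e) lerD ?(ltW xc)//.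
by apply: c0_norm_le => n; rewrite -[(x - l) n]/(x n - l n) lL.
Qed.

HB.instance Definition _ := Uniform_isComplete.Build c0 c0_complete.

End c0_space.
Arguments c0 : clear implicits.

Section c0_dual.
Context {R : realType}.
Implicit Types c d : c0 R.

Lemma c0_addE c d k : (c + d) k = (c k : R) + (d k : R) :> R. Proof. by []. Qed.

Lemma c0_scaleE (a : R) c k : (a *: c) k = a * (c k : R) :> R. Proof. by []. Qed.

Let unit_exists n : exists c : c0 R, forall k, c k = (k == n)%:R.
Proof.
apply: c0_exists; apply/cvgrPdist_le => e e0; exists n.+1 => // k /= nk.
by rewrite gtn_eqF// sub0r normrN normr0 ltW.
Qed.

(** The unit vectors of [c0]. *)
Definition c0_unit n : c0 R := sval (cid (unit_exists n)).

Lemma c0_unitE n k : c0_unit n k = (k == n)%:R.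
Proof. by rewrite /c0_unit; case: cid. Qed.

Lemma c0_unit_sumE (b : nat -> R) M k :
  (\sum_(n < M) b n *: c0_unit n) k = if (k < M)%N then b k else 0 :> R.
Proof.
elim: M => [|M IH]; first by rewrite big_ord0.
rewrite big_ord_recr c0_addE IH c0_scaleE c0_unitE /= [in RHS]ltnS [in RHS]leq_eqVlt.
have [->|kM] := eqVneq k M.
  by rewrite ltnn add0r mulr1.
by rewrite mulr0 addr0.
Qed.

Lemma c0_dual_unit_sum (a : dual (c0 R)) (b : nat -> R) M :
  a (\sum_(n < M) b n *: c0_unit n) = \sum_(n < M) b n * (a (c0_unit n) : R) :> R.
Proof. by rewrite linear_sum; apply: eq_bigr => n _; rewrite linearZ. Qed.

(** Functionals on [c0] are summable along the unit vectors. *)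
Lemma c0_dual_summable (a : dual (c0 R)) M :
  \sum_(n < M) `|a (c0_unit n) : R| <= `|a|.
Proof.
pose b n : R := Num.sg (a (c0_unit n) : R).
have -> : \sum_(n < M) `|a (c0_unit n) : R| = a (\sum_(n < M) b n *: c0_unit n).
  by rewrite c0_dual_unit_sum; apply: eq_bigr => n _; rewrite normrEsg.
apply: le_trans (ler_norm _) _; apply: le_trans (dual_norm_ub _ _) _.
rewrite -[leRHS]mulr1 ler_wpM2l//; apply: c0_norm_le => k.
rewrite c0_unit_sumE; case: ifP => _; last by rewrite normr0.
by rewrite /b normr_sg; case: (_ != 0); rewrite ?mulr0n.
Qed.

Lemma c0_dual_tail (a : dual (c0 R)) (e : R) : 0 < e -> exists N, forall c,
  `|(a c : R) - \sum_(n < N) (c n : R) * (a (c0_unit n) : R)| <= `|c| * e.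
Proof.
move=> e0; pose S N := \sum_(n < N) `|a (c0_unit n) : R|.
have supS : has_sup (range S).
  by split; [exists (S 0%N), 0%N|exists `|a| => _ [N _ <-]; exact: c0_dual_summable].
have [_ [N _ <-] hN] := sup_adherent e0 supS.
exists N => c; apply/ler_addgt0Pr => d d0.
have d1 : 0 < d / (`|a| + 1) by rewrite divr_gt0// ltr_wpDl.
have /cvgrPdist_le/(_ _ d1)[M _ cM] := c0_cvg c.
pose L := maxn N M.
have NL : (N <= L)%N := leq_maxl _ _.
pose w := \sum_(n < L) (c n : R) *: c0_unit n.
have h1 : `|(a c : R) - a w| <= d.
  rewrite -[X in `|X|](linearB a); apply: le_trans (dual_norm_ub _ _) _.
  apply: (@le_trans _ _ (`|a| * (d / (`|a| + 1)))).
    rewrite ler_wpM2l//; apply: c0_norm_le => k.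
    rewrite -[(c - w) k]/((c k : R) - (w k : R)) c0_unit_sumE.
    case: ltnP => [_|Lk]; first by rewrite subrr normr0 ltW.
    rewrite subr0; have := cM k; rewrite /= sub0r normrN; apply.
    by apply: leq_trans Lk; rewrite leq_maxr.
  by rewrite mulrCA ger_pMr// ler_pdivrMr ?ltr_wpDl// mul1r lerDl.
have h2 : `|(a w : R) - \sum_(n < N) (c n : R) * (a (c0_unit n) : R)| <= `|c| * e.
  rewrite c0_dual_unit_sum.
  rewrite -!(big_mkord xpredT (fun n => (c n : R) * (a (c0_unit n) : R))).
  rewrite (@big_cat_nat _ _ _ N 0%N L)//= addrAC subrr add0r.
  apply: le_trans (ler_norm_sum _ _ _) _.
  apply: (@le_trans _ _ (`|c| * \sum_(N <= n < L) `|a (c0_unit n) : R|)).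
    rewrite mulr_sumr; apply: ler_sum => n _.
    by rewrite normrM ler_wpM2r//; exact: c0_coord_ub.
  rewrite ler_wpM2l//.
  have SE k : S k = \sum_(0 <= n < k) `|a (c0_unit n) : R| by rewrite /S big_mkord.
  have := sup_upper_bound supS (ex_intro2 _ _ L Logic.I erefl).
  by rewrite SE (@big_cat_nat _ _ _ N 0%N L)//= -SE; lra.
rewrite -[X in `|X|](subrKA (a w : R)) (addrC (`|c| * e)).
exact: le_trans (ler_normD _ _) (lerD h1 h2).
Qed.

(** On bounded sets, coordinatewise convergence in [c0] is weak convergence. *)
Lemma c0_weak_cvg (U : set_system (c0 R)) (l : c0 R) (C : R) : ProperFilter U ->
  (\forall c \near U, `|c| <= C) -> (forall n, (fun c : c0 R => c n : R) @ U --> (l n : R)) ->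
  U --> (l : weak (c0 R)).
Proof.
move=> UU UC Ul; apply/weak_filter_cvgP => a; apply/cvgrPdist_le => e e0.
pose K := `|l| + `|C| + 1.
have K0 : 0 < K by rewrite ltr_wpDl// addr_ge0.
have e1 : 0 < e / (2 * K) by rewrite divr_gt0// mulr_gt0.
have [N hN] := c0_dual_tail a e1.
have : (fun c : c0 R => \sum_(n < N) (c n : R) * (a (c0_unit n) : R)) @ U -->
    \sum_(n < N) (l n : R) * (a (c0_unit n) : R).
  elim: N {hN} => [|N IH].
    by rewrite big_ord0; under eq_fun do rewrite big_ord0; exact: cvg_cst.
  rewrite big_ord_recr; under eq_fun do rewrite big_ord_recr.
  by apply: cvgD IH _; apply: cvgMl; exact: Ul.
have e2 : 0 < e / 2 by rewrite divr_gt0.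
move=> /cvgrPdist_le/(_ _ e2); apply: filterS2 UC => c cC cs.
have := hN (l - c).
have lc : `|l - c| <= K.
  apply: le_trans (ler_normB _ _) _; rewrite /K -addrA lerD2l.
  by apply: le_trans cC _; apply: le_trans (ler_norm _) _; rewrite lerDl.
have -> : \sum_(n < N) ((l - c) n : R) * (a (c0_unit n) : R) =
    \sum_(n < N) (l n : R) * (a (c0_unit n) : R) -
    \sum_(n < N) (c n : R) * (a (c0_unit n) : R).
  by rewrite -sumrB; apply: eq_bigr => n _; rewrite -mulrBl.
rewrite linearB /=.
have h : `|l - c| * (e / (2 * K)) <= e / 2.
  apply: le_trans (ler_wpM2r (ltW e1) lc) _.
  by rewrite (_ : K * (e / (2 * K)) = e / 2)//; field; rewrite gt_eqF.
have aux (p q s t : R) : `|s - t| <= e / 2 -> `|p - q - (s - t)| <= e / 2 -> `|p - q| <= e.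
  move=> h1 h2; rewrite -(subrK (s - t) (p - q)); apply: le_trans (ler_normD _ _) _; lra.
by move=> h2; exact: aux cs (le_trans h2 h).
Qed.

Lemma c0_weak_hausdorff : hausdorff_space (weak (c0 R)).
Proof.
apply: weak_hausdorff => c d cd; apply: val_inj; apply/funext => n.
have [f fE] : exists f : dual (c0 R), forall c, f c = c n.
  apply: (@dual_exists _ (c0 R) (fun c : c0 R => c n) 1) => // c'.
  by rewrite mul1r; exact: c0_coord_ub.
by have := cd f; rewrite !fE.
Qed.

End c0_dual.

(** * The Dunford-Pettis property *)

Section dunford_pettis.
Context {R : realType} (X : completeNormedModType R).

(** By the Banach-Steinhaus theorem. *)
Lemma weakly_null_dual_bounded (f : nat -> dual X) : weakly_null f ->
  exists M, forall n, `|f n| <= M.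
Proof.
move=> /weak_cvgP f0.
have fx x : f n x @[n --> \oo] --> (0 : R).
  have [phi phiE] := bidual_eval x; have := f0 phi; rewrite linear0.
  by under eq_fun do rewrite phiE.
have [||M HM] := @Banach_Steinhauss R X R^o (range (fun n => f n : X -> R^o)) _ _ 1.
- move=> _ [n _ <-]; split; last exact: dual_linear.
  move=> r; exists (`|f n| * r) => x xr; apply: le_trans (dual_norm_ub _ _) _.
  by rewrite ler_wpM2l.
- move=> x; have /cvg_seq_bounded/ex_strict_bound_gt0[M _ cM] :
      cvgn (fun n => f n x : R^o) by apply/cvg_ex; exists 0; exact: fx.
  by exists M => _ [n _ <-]; exact: ltW (cM n Logic.I).
exists M => n; apply: dual_norm_le => x x1.
by apply: HM => //; exists n.
Qed.

(** The operator [x |-> (f_n x)_n] into [c0] is weakly compact when [(f_n)] is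
    weakly null: the image of the ball lies in the set of all [(phi f_n)_n] with
    [phi] in the bidual ball, which is weakly compact. It is therefore completely
    continuous. *)
Lemma dunford_pettis_weakly_null (x : nat -> X) (f : nat -> dual X) :
  dunford_pettis_property X -> weakly_null x -> weakly_null f ->
  forall e, 0 < e -> \forall k \near \oo, forall n, `|f n (x k)| <= e.
Proof.
move=> dpp x0 fw e e0; have [M fM] := weakly_null_dual_bounded fw.
have /weak_cvgP f0 := fw.
have phi0 (phi : dual (dual X)) : phi (f n) @[n --> \oo] --> (0 : R).
  by have := f0 phi; rewrite linear0.
have /choice[T TE] y : exists c : c0 R, forall n, c n = f n y.
  apply: c0_exists; have [phi phiE] := bidual_eval y.
  by have := phi0 phi; under eq_fun do rewrite phiE.
have lT : linear T.
  move=> a y z; apply: val_inj; apply/funext => n /=.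
  rewrite -[LHS]/(T (a *: y + z) n) -[RHS]/(a * (T y n : R) + (T z n : R)).
  by rewrite !TE linearD linearZ.
have M0 : 0 <= M by apply: le_trans (fM 0%N).
have TM y : `|T y| <= M * `|y|.
  apply: c0_norm_le => n; rewrite TE; apply: le_trans (dual_norm_ub _ _) _.
  by rewrite ler_wpM2r.
pose T' : {linear X -> c0 R} := HB.pack T (GRing.isLinear.Build _ _ _ _ _ lT).
have cT : continuous T' by exact: linear_le_continuous lT TM.
pose K := [set c : c0 R | exists phi : dual (dual X),
  (forall h, `|phi h| <= `|h|) /\ forall n, c n = phi (f n)].
have KC c : K c -> `|c| <= M.
  move=> [phi [phi1 cE]]; apply: c0_norm_le => n; rewrite cE.
  exact: le_trans (phi1 _) (fM n).
have cK : compact (K : set (weak (c0 R))).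
  rewrite compact_ultra => F FU FK.
  have /choice[P PE] c : exists phi : dual (dual X), K c ->
      (forall h, `|phi h| <= `|h|) /\ forall n, c n = phi (f n).
    have [[phi phiE]|nK] := pselect (K c); first by exists phi.
    by exists 0.
  have PC : \forall c \near F, forall h, `|P c h| <= 1 * `|h|.
    by apply: filterS FK => c /PE[Ph _] h; rewrite mul1r.
  have [phi [phi1 phiE]] := dual_ultra_limit FU PC.
  have [l lE] := c0_exists (phi0 phi).
  exists l; split.
    by exists phi; split=> // h; rewrite -[leRHS]mul1r.
  apply: (@c0_weak_cvg R F l M) => [|n].
    by apply: filterS FK => c; exact: KC.
  rewrite lE; apply: cvg_trans (phiE (f n)).
  apply: near_eq_cvg; apply: filterS FK => c /PE[_ ->] //.
have wT : weakly_compact_operator T'.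
  apply: (@precompact_subset (weak (c0 R)) _ K); last first.
    exact: compact_precompact (@c0_weak_hausdorff R) cK.
  move=> _ [y /= y1 <-]; have [phi phiE] := bidual_eval y.
  exists phi; split=> [h|n]; last by rewrite phiE; exact: TE.
  rewrite phiE; apply: le_trans (dual_norm_ub _ _) _.
  by rewrite -[leRHS]mulr1 ler_wpM2l.
have /cvgrPdist_le/(_ _ e0) := dpp _ T' cT wT x x0.
apply: filterS => k; rewrite sub0r normrN => Tk n.
by rewrite -TE; exact: le_trans (c0_coord_ub _ _) Tk.
Qed.

Lemma dunford_pettis_dp_set (x : nat -> X) (K : R) :
  dunford_pettis_property X -> weakly_null x -> (forall k, `|x k| <= K) ->
  dp_set (range x).
Proof.
move=> dpp x0 xK; split.
  exists K; split; rewrite ?num_real// => M KM _ [k _ <-].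
  exact: le_trans (xK k) (ltW KM).
move=> f f0; apply/cvgrPdist_le => e e0.
have [N _ hN] := dunford_pettis_weakly_null dpp x0 f0 e0.
have small : \forall n \near \oo, forall k, (k < N)%N -> `|f n (x k)| <= e.
  elim: N {hN} => [|N IH]; first by near=> n.
  have [phi phiE] := bidual_eval (x N).
  have /weak_cvgP/(_ phi) := f0; rewrite linear0 => /cvgrPdist_le/(_ _ e0).
  apply: filterS2 IH => n hn; rewrite sub0r normrN phiE => hN k.
  by rewrite ltnS leq_eqVlt => /predU1P[->|/hn].
apply: filterS small => n hn; rewrite sub0r normrN ger0_norm; last first.
  apply: le_trans (normr_ge0 (f n (x 0%N))) _.
  apply: sup_upper_bound; last by exists (x 0%N) => //; exists 0%N.
  split; first by exists `|f n (x 0%N)|, (x 0%N) => //; exists 0%N.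
  exists (`|f n| * K) => _ [_ [k _ <-] <-].
  by apply: le_trans (dual_norm_ub _ _) _; rewrite ler_wpM2l.
apply: ge_sup; first by exists `|f n (x 0%N)|, (x 0%N) => //; exists 0%N.
move=> _ [_ [k _ <-] <-]; have [kN|Nk] := ltnP k N; first exact: hn.
exact: hN.
Unshelve. all: by end_near. Qed.

End dunford_pettis.

(** * The Grothendieck property and disjoint sequences *)

Section grothendieck.
Context {R : realType} {E : banachLatticeType R}.
Implicit Types (x y z w : E) (h : E -> R).

Lemma cone_natmul (C : R) h n x : cone_functional C h -> 0 <=v x ->
  h (n%:R *: x) = n%:R * h x.
Proof.
move=> ch x0; elim: n => [|n IH]; first by rewrite scale0r mul0r (cone0 ch).
rewrite -addn1 natrD scalerDl scale1r (coneD ch)//; last first.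
  by apply: vl_scaler_ge0; rewrite ?ler0n.
by rewrite IH mulrDl mul1r.
Qed.

(** Additivity and monotonicity on the cone imply positive homogeneity. *)
Lemma coneZ (C : R) h (t : R) x : cone_functional C h -> 0 <= t -> 0 <=v x ->
  h (t *: x) = t * h x.
Proof.
move=> ch t0 x0; have hx0 := cone_ge0 ch x0.
have key n : n%:R * `|h (t *: x) - t * h x| <= h x.
  have nt0 : 0 <= n%:R * t by rewrite mulr_ge0.
  pose k := Num.truncn (n%:R * t).
  have k1 : k%:R <= n%:R * t by rewrite truncn_le.
  have k2 : n%:R * t <= k.+1%:R by apply: ltW; rewrite truncnS_gt.
  have tx0 : 0 <=v t *: x by exact: vl_scaler_ge0.
  have lo : k%:R * h x <= n%:R * h (t *: x).
    rewrite -!(cone_natmul _ ch)// scalerA; apply: (cone_mono ch).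
      by apply: vl_scaler_ge0.
    exact: vl_leZl.
  have hi : n%:R * h (t *: x) <= k.+1%:R * h x.
    rewrite -!(cone_natmul _ ch)// scalerA; apply: (cone_mono ch).
      by apply: vl_scaler_ge0.
    exact: vl_leZl.
  rewrite -[n%:R]ger0_norm// -normrM mulrBr mulrA ler_norml.
  have := ler_wpM2r hx0 k1; have := ler_wpM2r hx0 k2.
  by move: hi; rewrite -[k.+1]addn1 natrD; lra.
apply/eqP; rewrite -subr_eq0 -normr_le0 leNgt; apply/negP => d0.
have := key (Num.truncn (h x / `|h (t *: x) - t * h x|)).+1.
apply/negP; rewrite -ltNge -ltr_pdivrMr//.
by rewrite truncnS_gt.
Qed.

(** A cone functional extends to a bounded linear functional. *)
Lemma cone_extend (C : R) h : 0 <= C -> cone_functional C h ->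
  exists f : dual E, forall x, f x = h (vl_pos x) - h (vl_pos (- x)).
Proof.
move=> C0 ch; pose g x : R^o := h (vl_pos x) - h (vl_pos (- x)).
have p0 x := vl_pos_ge0 x.
(* the value depends only on the difference of two positive vectors *)
have gE x y z : 0 <=v y -> 0 <=v z -> x = y - z -> g x = h y - h z.
  move=> y0 z0 xyz.
  have : h (vl_pos x + z) = h (y + vl_pos (- x)).
    congr h; have e : vl_pos x - vl_pos (- x) = y - z by rewrite vl_posB.
    have -> : vl_pos x + z = (vl_pos x - vl_pos (- x)) + (z + vl_pos (- x)) by lmodule R E.
    by rewrite e; lmodule R E.
  by rewrite !(coneD ch)// /g => ?; rewrite -[LHS]/(_ - _ : R); lra.
have gN x : g (- x) = - g x by rewrite /g opprK opprB.
have gZ (t : R) x : 0 <= t -> g (t *: x) = t * g x.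
  move=> t0; rewrite (gE _ (t *: vl_pos x) (t *: vl_pos (- x))).
  - by rewrite !(coneZ ch)// -mulrBr.
  - exact: vl_scaler_ge0.
  - exact: vl_scaler_ge0.
  - by rewrite -scalerBr vl_posB.
have gD x y : g (x + y) = g x + g y.
  rewrite (gE _ (vl_pos x + vl_pos y) (vl_pos (- x) + vl_pos (- y))).
  - by rewrite !(coneD ch)// /g opprD addrACA.
  - exact: vl_addr_ge0.
  - exact: vl_addr_ge0.
  - by rewrite opprD addrACA !vl_posB.
have gl : linear g.
  move=> t x y; rewrite gD; congr (_ + _).
  have [t0|t0] := leP 0 t; first exact: gZ.
  rewrite -[t *: x]opprK gN -scaleNr gZ ?oppr_ge0 ?ltW//.
  by rewrite mulNr opprK.
have gC x : `|g x| <= (C + C) * `|x|.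
  apply: le_trans (ler_normB _ _) _; rewrite mulrDl.
  rewrite !ger0_norm ?(cone_ge0 ch)//; apply: lerD; apply: le_trans (cone_le ch (p0 _)) _.
    by rewrite ler_wpM2l// vl_norm_pos.
  by rewrite ler_wpM2l// -(normrN x) vl_norm_pos.
exact: dual_exists gl gC.
Qed.

(** The restriction of a cone functional to the band generated by [w]:
    [y |-> sup_k h (y /\ k w)] on the cone. *)
Definition cone_band h w y : R := sup (range (fun k : nat => h (vl_meet y (k%:R *: w)))).

Section cone_band_theory.
Variables (C : R) (h : E -> R).
Hypothesis ch : cone_functional C h.

Let meet0 y w (k : nat) : 0 <=v y -> 0 <=v w -> 0 <=v vl_meet y (k%:R *: w).
Proof. by move=> y0 w0; apply: vl_meet_ge0 => //; apply: vl_scaler_ge0. Qed.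

Lemma cone_band_has_sup w y : 0 <=v w -> 0 <=v y ->
  has_sup (range (fun k : nat => h (vl_meet y (k%:R *: w)))).
Proof.
move=> w0 y0; split; first by exists (h (vl_meet y (0%:R *: w))), 0%N.
exists (h y) => _ [k _ <-]; apply: (cone_mono ch) (vl_lem_l _ _).
exact: meet0.
Qed.

Lemma cone_band_ub w y (k : nat) : 0 <=v w -> 0 <=v y ->
  h (vl_meet y (k%:R *: w)) <= cone_band h w y.
Proof. by move=> w0 y0; apply: (sup_upper_bound (cone_band_has_sup w0 y0)); exists k. Qed.

Lemma cone_band_lub w y (c : R) :
  (forall k : nat, h (vl_meet y (k%:R *: w)) <= c) -> cone_band h w y <= c.
Proof.
move=> hc; apply: ge_sup; first by exists (h (vl_meet y (0%:R *: w))), 0%N.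
by move=> _ [k _ <-].
Qed.

Lemma cone_band_le w y : 0 <=v w -> 0 <=v y -> cone_band h w y <= h y.
Proof.
move=> w0 y0; apply: cone_band_lub => k; apply: (cone_mono ch) (vl_lem_l _ _).
exact: meet0.
Qed.

Lemma cone_bandP w : 0 <=v w -> cone_functional C (cone_band h w).
Proof.
move=> w0; split=> [x y x0 y0|x x0|x x0]; last 2 first.
- apply: le_trans (cone_band_ub 0 w0 x0); apply: (cone_ge0 ch); exact: meet0.
- exact: le_trans (cone_band_le w0 x0) (cone_le ch x0).
have xy0 := vl_addr_ge0 x0 y0.
apply: le_anti; apply/andP; split.
  apply: cone_band_lub => k.
  have kw0 : 0 <=v k%:R *: w by apply: vl_scaler_ge0.
  apply: (@le_trans _ _ (h (vl_meet x (k%:R *: w) + vl_meet y (k%:R *: w)))).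
    apply: (cone_mono ch); first exact: meet0.
    by rewrite vl_meetC (vl_meetC x) (vl_meetC y); exact: vl_meetD.
  by rewrite (coneD ch) ?meet0// lerD// cone_band_ub.
rewrite -lerBrDr; apply: cone_band_lub => k.
rewrite lerBrDr addrC -lerBrDr; apply: cone_band_lub => l.
rewrite lerBrDr addrC -(coneD ch) ?meet0//.
apply: le_trans (cone_band_ub (k + l) w0 xy0).
apply: (cone_mono ch); first by apply: vl_addr_ge0; exact: meet0.
apply: vl_lemeet; first by apply: vl_leDD; exact: vl_lem_l.
by rewrite natrD scalerDl; apply: vl_leDD; exact: vl_lem_r.
Qed.

Lemma cone_band_mono w w' y : 0 <=v w -> w <=v w' -> 0 <=v y ->
  cone_band h w y <= cone_band h w' y.
Proof.
move=> w0 ww y0; apply: cone_band_lub => k.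
apply: le_trans (cone_band_ub k (vl_trans w0 ww) y0).
apply: (cone_mono ch); first exact: meet0.
by apply: vl_meet_mono; rewrite ?vl_lexx//; apply: vl_leZr.
Qed.

End cone_band_theory.

(** Norm bounded disjoint sequences are weakly null. If [|f|(x_n) >= e] for
    infinitely many [n], the restrictions [s_N] of [|f|] to the bands of
    [x_0 + .. + x_(N-1)] increase to a functional [s] in the weak* topology, hence
    weakly; but a bidual cluster point of these [x_n] vanishes at every [s_N] and
    not at [s]. *)
Lemma grothendieck_disjoint_weakly_null (x : nat -> E) (K : R) :
  grothendieck_property E -> disjoint_seq x -> (forall n, `|x n| <= K) ->
  weakly_null x.
Proof.
move=> gE [x0 xd] xK; apply/weak_cvgP => f; rewrite linear0.
apply/cvgrPdist_le => e e0; apply: contrapT => H.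
have {H} /choice[k kP] N : exists n, (N <= n)%N /\ e < `|f (x n)|.
  apply: contrapT => HN; apply: H; exists N => // n /= Nn.
  rewrite sub0r normrN leNgt; apply/negP => fn; apply: HN; by exists n.
have ca : cone_functional `|f| (dual_abs f).
  by apply: dual_abs_cone => // y; exact: dual_norm_ub.
set a := dual_abs f in ca.
pose w N := \sum_(i < N) x i.
have w0 N : 0 <=v w N.
  by rewrite /w; elim/big_ind : _ => [|y z|i _]; rewrite ?vl_lexx//; exact: vl_addr_ge0.
have wS N : w N <=v w N.+1.
  by rewrite /w big_ord_recr/= -[X in X <=v _]addr0; apply: vl_leDD; rewrite ?vl_lexx.
pose s N := cone_band a (w N).
have cs N : cone_functional `|f| (s N) by exact: cone_bandP.
have sle N M y : 0 <=v y -> (N <= M)%N -> s N y <= s M y.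
  move=> y0; elim: M => [|M IH]; first by rewrite leqn0 => /eqP ->.
  rewrite leq_eqVlt => /predU1P[->//|]; rewrite ltnS => /IH h; apply: le_trans h _.
  apply: (cone_band_mono ca) => //; exact: wS.
pose t y := sup (range (fun N => s N y)).
have st y : 0 <=v y -> s N y @[N --> \oo] --> t y.
  move=> y0; apply: nondecreasing_cvgn => [N M NM|]; first exact: sle.
  by exists (a y) => _ [N _ <-]; exact: (cone_band_le ca).
have st_le y N : 0 <=v y -> s N y <= t y.
  move=> y0; apply: sup_upper_bound; last by exists N.
  split; first by exists (s 0%N y), 0%N.
  by exists (a y) => _ [M _ <-]; exact: (cone_band_le ca).
have ct : cone_functional `|f| t.
  split=> [y z y0 z0|y y0|y y0].
  - have yz0 := vl_addr_ge0 y0 z0.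
    apply: (@cvg_unique R (@Rhausdorff R) (s N (y + z) @[N --> \oo])).
      exact: st.
    have -> : (fun N => s N (y + z)) = (fun N => s N y + s N z).
      by apply/funext => N; exact: (coneD (cs N)).

    by apply: cvgD; exact: st.
  - by apply: le_trans (st_le y 0%N y0); exact: (cone_ge0 (cs _)).
  - apply: ge_sup; first by exists (s 0%N y), 0%N.
    by move=> _ [N _ <-]; exact: (cone_le (cs N)).
have extP y (g : dual E) (h : E -> R) : (forall y, g y = h (vl_pos y) - h (vl_pos (- y))) ->
    h 0 = 0 -> 0 <=v y -> g y = h y :> R.
  move=> gh h0 y0; rewrite gh vl_pos_id//.
  have -> : vl_pos (- y) = 0.
    by apply: vl_eq; rewrite ?vl_pos_ge0// vl_pos_le ?vl_lexx// -oppr0 vl_leN.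
  by rewrite h0 subr0.
have /choice[S SP] N := cone_extend (normr_ge0 f) (cs N).
have [L LP] := cone_extend (normr_ge0 f) ct.
have SE N y : 0 <=v y -> S N y = s N y :> R by apply: extP => //; exact: (cone0 (cs N)).
have LE y : 0 <=v y -> L y = t y :> R by apply: extP => //; exact: (cone0 ct).
have /gE/weak_cvgP SL : weak_star_cvg S L.
  apply/weak_star_cvgP => y; rewrite LP; under eq_fun do rewrite SP.
  by apply: cvgB; apply: st; exact: vl_pos_ge0.
have [U [UU ooU]] := ultraFilterLemma (eventually_filter : ProperFilter \oo).
have /choice[J JE] n := bidual_eval (x (k n)).
have JK : \forall n \near U, forall g, `|J n g| <= K * `|g|.
  apply: ooU; near=> n => g; rewrite JE mulrC; apply: le_trans (dual_norm_ub _ _) _.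
  by rewrite ler_wpM2l.
have [phi [_ phiE]] := dual_ultra_limit UU JK.
have phiS N : phi (S N) = 0.
  apply: (@cvg_unique R (@Rhausdorff R) (J n (S N) @[n --> U])); first exact: phiE.
  apply: cvg_near_cst; apply: ooU; exists N => // n /= Nn.
  rewrite JE SE//; apply: le_anti; rewrite (cone_ge0 (cs N))// andbT.
  apply: cone_band_lub => j.
  suff -> : vl_meet (x (k n)) (j%:R *: w N) = 0 by rewrite (cone0 ca).
  have Nk : (N <= k n)%N by apply: leq_trans Nn _; case: (kP n).
  apply: vl_eq; last first.
    by apply: vl_meet_ge0 => //; apply: vl_scaler_ge0.
  have wN M : (M <= k n)%N -> vl_meet (x (k n)) (j%:R *: w M) <=v 0.
    elim: M => [|M IH] Mk.
      by rewrite /w big_ord0 scaler0; exact: vl_lem_r.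
    rewrite /w big_ord_recr /= scalerDr.
    apply: vl_trans (vl_meetD _ _ _) _ => //.
      by apply: vl_scaler_ge0 => //; exact: w0.
      by apply: vl_scaler_ge0.
    rewrite -[X in _ <=v X]addr0; apply: vl_leDD; first exact: IH (ltnW Mk).
    have [->|j0] := eqVneq j 0%N; first by rewrite scale0r; exact: vl_lem_r.
    (* a multiple of [x_M] is disjoint from [x_(k n)] *)
    apply: (@vl_trans _ _ (vl_meet (j%:R *: x (k n)) (j%:R *: x M))).
      apply: vl_meet_mono; rewrite ?vl_lexx// -[X in X <=v _]scale1r.
      by apply: vl_leZl => //; rewrite ler1n lt0n.
    rewrite -vl_meetZ ?ltr0n ?lt0n// vl_meetC xd// scaler0; exact: vl_lexx.
  exact: wN.
have phiL : e <= phi L.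
  have eJ n : e <= J n L.
    rewrite JE LE//; have [_ /ltW en] := kP n; apply: le_trans en _.
    apply: le_trans (dual_abs_norm_ub _ _) _; rewrite vl_absE// -/a.
    apply: le_trans (st_le _ (k n).+1 (x0 _)).
    apply: le_trans (cone_band_ub ca 1 (w0 _) (x0 _)).
    rewrite scale1r; apply: (cone_mono ca) => //; apply: vl_lemeet; rewrite ?vl_lexx//.
    rewrite /w big_ord_recr /= -[X in X <=v _]add0r.
    by apply: vl_leDD; [exact: w0|exact: vl_lexx].
  apply/ler_addgt0Pr => d d0; have /cvgrPdist_le/(_ _ d0) := phiE L.
  move=> /(@filter_ex _ U _)[n]; rewrite ler_distl => /andP[h _].
  by rewrite -lerBlDr; apply: le_trans h; rewrite lerD2r.
have : phi L = 0.
  apply: (@cvg_unique R (@Rhausdorff R) (phi (S N) @[N --> \oo])); first exact: SL.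
  by apply: cvg_near_cst; near=> N.
by move=> p0; move: phiL; rewrite p0 leNgt e0.
Unshelve. all: by end_near. Qed.

End grothendieck.

(** * Weak compactness *)

(** The functionals dominated by [A]: those [f] with [|f x| <= sup_A |h x|] for
    all [x], where the supremum is [0] when [A] is empty. *)
Definition dual_dominated (R : realType) (X : normedModType R) (A : set (dual X)) :
    set (dual X) :=
  [set f | forall (x : X) (c : R), 0 <= c -> (forall h, A h -> `|h x| <= c) ->
    `|f x| <= c].

Section weak_compactness.
Context {R : realType} {E : banachLatticeType R}.

(** If the sequences of functionals dominated by the bounded set [A] are uniformly
    null on disjoint sequences, then these functionals form a weakly compact set.
    The set is weak* compact; were the weak* limit [f] of an ultrafilter not
    its weak limit, a functional [phi] of the bidual would tell them apart, and
    alternating choices from the ultrafilter and from Helly's theorem would give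
    sequences with distinct iterated limits. *)
Lemma dual_dominated_weakly_compact (A : set (dual E)) (M : R) :
  (forall h, A h -> `|h| <= M) ->
  (forall f : nat -> dual E, (forall n, dual_dominated A (f n)) -> disj_unif_null f) ->
  compact (dual_dominated A : set (weak (dual E))).
Proof.
move=> AM Anull; pose M' := `|M|.
have A1M f : dual_dominated A f -> forall x, `|f x| <= M' * `|x|.
  move=> Af x; apply: Af => [|h Ah]; first by rewrite mulr_ge0 ?normr_ge0.
  apply: le_trans (dual_norm_ub _ _) _; rewrite ler_wpM2r//.
  exact: le_trans (AM h Ah) (ler_norm _).
rewrite compact_ultra => F FU FA.
have FM : \forall h \near F, forall x, `|(h : dual E) x| <= M' * `|x|.
  by apply: filterS FA => h; exact: A1M.
have [f [fM fE]] := @dual_ultra_limit R E (dual E) F id M' FU FM.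
have Af : dual_dominated A f.
  move=> x c c0 hc; apply: cvg_norm_ub (fE x) _; apply: filterS FA => h /=; exact.
exists f; split=> //; apply/weak_filter_cvgP => phi.
have phiM h : dual_dominated A h -> `|phi h| <= `|phi| * M'.
  move=> Ah; apply: le_trans (dual_norm_ub _ _) _; rewrite ler_wpM2l//.
  apply: dual_norm_le => x x1; apply: le_trans (A1M h Ah x) _.
  by rewrite -[leRHS]mulr1 ler_wpM2l// normr_ge0.
have [L phiL] : exists l : R, phi h @[h --> F] --> l.
  apply: (@ultra_bounded_cvg R (dual E) F (fun h => phi h) (`|phi| * M')).
  by apply: filterS FA.
suff -> : phi f = L by [].
apply: contrapT => Lf.
have eps0 : 0 < `|L - phi f| / 12.
  by rewrite divr_gt0// normr_gt0 subr_eq0 eq_sym; apply/eqP.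
set eps := `|L - phi f| / 12 in eps0.
have C0 : 0 < `|phi| + 1 by rewrite ltr_wpDl.
have phiC (h : dual E) : `|phi h| <= (`|phi| + 1) * `|h|.
  by apply: le_trans (dual_norm_ub _ _) _; rewrite ler_wpM2r// lerDl.
have /choice[next nextP] (s : seq (dual E * E)) : exists p : dual E * E,
    [/\ dual_dominated A p.1, `|L - phi p.1| <= eps,
        forall q, q \in s -> `|f q.2 - p.1 q.2 : R| <= eps,
        `|p.2| <= `|phi| + 1
      & forall h, h \in p.1 :: f :: map fst s -> `|phi h - h p.2| <= eps].
  have near_s : \forall h \near F, forall q, q \in s -> `|f q.2 - (h : dual E) q.2 : R| <= eps.
    elim: s => [|q s IH]; first by apply: filterS FA.
    have /cvgrPdist_le/(_ _ eps0) := fE q.2.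
    by apply: filterS2 IH => h hs hq q'; rewrite inE => /predU1P[->|/hs].
  have /cvgrPdist_le/(_ _ eps0) near_phi := phiL.
  have [g [Ag [gL gs]]] := @filter_ex _ F _ _ (filterI FA (filterI near_phi near_s)).
  have [z [zC zh]] := helly (g :: f :: map fst s) C0 phiC eps0.
  by exists (g, z).
pose hist := fix hist n : seq (dual E * E) :=
  if n is n'.+1 then next (hist n') :: hist n' else [::].
have histP k n : (k < n)%N -> next (hist k) \in hist n.
  elim: n => // n IH; rewrite ltnS leq_eqVlt => /predU1P[->|/IH h] /=.
    by rewrite inE eqxx.
  by rewrite inE h orbT.
pose g n := (next (hist n)).1; pose z n := (next (hist n)).2.
have gA n : dual_dominated A (g n) by case: (nextP (hist n)).
have tri (p q r : R) : `|p - q| <= eps -> `|p - r| <= eps -> `|q - r| <= 2 * eps.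
  by rewrite !ler_norml => /andP[? ?] /andP[? ?]; apply/andP; split; lra.
have h1 n k : (n <= k)%N -> `|g n (z k) - L| <= 2 * eps.
  move=> nk; apply: (tri (phi (g n))).
    have [_ _ _ _] := nextP (hist k); apply; rewrite !inE.
    move: nk; rewrite leq_eqVlt => /predU1P[->|nk]; first by rewrite eqxx.
    by rewrite (map_f fst (histP _ _ nk)) !orbT.
  by rewrite distrC; case: (nextP (hist n)).
have h2 n k : (k < n)%N -> `|g n (z k) - phi f| <= 2 * eps.
  move=> kn; apply: (tri (f (z k))).
    by have [_ _ + _ _] := nextP (hist n); apply; exact: histP.
  rewrite distrC; have [_ _ _ _] := nextP (hist k); apply.
  by rewrite !inE eqxx orbT.
have zC k : `|z k| <= `|phi| + 1 by case: (nextP (hist k)).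
have M0 : 0 <= M' by exact: normr_ge0.
have e20 : 0 < 2 * eps by rewrite mulr_gt0.
have := disj_unif_null_iterated M0 (fun n => A1M _ (gA n)) (Anull _ gA) zC e20 h1 h2.
move: eps0; rewrite /eps; set d := `|L - phi f|; lra.
Qed.

Lemma dual_weak_hausdorff (X : normedModType R) : hausdorff_space (weak (dual X)).
Proof.
apply: weak_hausdorff => f g fg; apply: dual_ext => x.
by have [phi phiE] := bidual_eval x; rewrite -!phiE.
Qed.

(** With the Dunford-Pettis and Grothendieck properties, norm bounded disjoint
    sequences are weakly null DP sets, hence test sequences for L-DP sets. *)
Lemma l_dp_set_disj (A : set (dual E)) (x : nat -> E) (K : R) :
  dunford_pettis_property E -> grothendieck_property E -> l_dp_set A ->
  disjoint_seq x -> (forall n, `|x n| <= K) -> forall eps, 0 < eps ->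
  exists N, forall n, (N <= n)%N -> forall h, A h -> `|h (x n)| <= eps.
Proof.
move=> dpp gE [Ab Adp] xd xK eps eps0.
have x0 := grothendieck_disjoint_weakly_null gE xd xK.
have := Adp x x0 (dunford_pettis_dp_set dpp x0 xK).
have [M M0 AM] := ex_strict_bound_gt0 Ab.
move=> /cvgrPdist_le/(_ _ eps0)[N _ hN]; exists N => n Nn h Ah.
have := hN n Nn; rewrite sub0r normrN => /(le_trans (ler_norm _)); apply: le_trans.
apply: sup_upper_bound; last by exists h.
split; first by exists `|h (x n)|, h.
exists (M * `|x n|) => _ [h' Ah' <-]; apply: le_trans (dual_norm_ub _ _) _.
by rewrite ler_wpM2r// ltW//; exact: AM.
Qed.

End weak_compactness.

Theorem theorem2p8 (R : realType) (E : banachLatticeType R) :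
  dunford_pettis_property E -> grothendieck_property E ->
  l_dunford_pettis_property E.
Proof.
move=> dpp gE A Adp.
apply: (@precompact_subset (weak (dual E)) _ (dual_dominated A)).
  by move=> f Af x c _; exact.
apply: compact_precompact; first exact: dual_weak_hausdorff.
have [Ab _] := Adp; have [M M0 AM] := ex_strict_bound_gt0 Ab.
apply: (@dual_dominated_weakly_compact _ _ _ M) => [h Ah|f fA].
  exact: ltW (AM h Ah).
move=> x K xd xK eps eps0.
have [N hN] := l_dp_set_disj dpp gE Adp xd xK eps0.
exists N => k Nk n; apply: fA; first exact: ltW.
by move=> h Ah; exact: hN.
Qed.
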